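(* Let $n,N\ge1$ and consider the nonlinearly coupled network $$\dot x_i=f_i(t,x_i)-c\sum_{j=1}^Na_{ij}\,\eta(t,x_i-x_j),\qquad i=1,\dots,N,$$ on a connected undirected weighted graph, with $x_i\in\mathbb R^n$, where $f_i(t,x)=h(t,x)+g_i(t,x)$ are QUAD$(I_n,W)$ Affine (continuous or piecewise smooth) vector fields with the same QUAD component $h$ for all $i$, and with $\|\tilde g_i(t,x)\|_2<M_i<+\infty$ for all $\tilde g_i(t,x)\in\mathcal F[g_i](t,x)$, all $t>0$ and $x\in\mathbb R^n$. Let $\overline M=\max_iM_i$. Assume the first $\bar r\in\{0,\dots,n\}$ diagonal elements of $W$ are non-negative, while the remaining $n-\bar r$ are negative. Assume the (possibly discontinuous) coupling function $\eta:\mathbb R^+\times\mathbb R^n\to\mathbb R^n$ is component-wise odd, $\eta(t,-v)=-\eta(t,v)$, and that for some $e_{\max}>0$ and some diagonal $\Upsilon=\mathrm{diag}\{\upsilon_i\}_{i=1}^n$ with $\upsilon_i>0$ for $i\le r$ and $\upsilon_i=0$ for $i>r$ ($1\le r\le n$), $$z^T\tilde\eta(t,z)\ge z^T\Upsilon z\qquad\forall t\in\mathbb R^+,\ \forall z:\|z\|_2\le e_{\max},\ \forall\tilde\eta(t,z)\in\mathcal F[\eta](t,z),$$ with $r\ge\bar r$. Suppose further that (i) the initial error satisfies $\|e(0)\|_2\le e_{\max}/2$; (ii) $\displaystyle-\frac{\sqrt N\,\overline M}{\lambda_{\max}(W_{n-r})}\le\frac{e_{\max}}2$. Then, choosing a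 coupling gain $c>\tilde c$ with $$\tilde c=\max\left\{\frac1{\lambda_2(L\otimes\Upsilon_r)}\left(\frac{2\sqrt N\,\overline M}{e_{\max}}+\lambda_{\max}(W_r)\right),0\right\},$$ the network achieves $\epsilon$-bounded convergence. Furthermore, an upper bound on $\epsilon$ is $$\bar\epsilon=\frac{\overline M\sqrt N}{m_{\mathrm{nl}}(c,W)},\qquad m_{\mathrm{nl}}(c,W)=-\max\{\lambda_{\max}(W_r)-c\,\lambda_2(L\otimes\Upsilon_r),\ \lambda_{\max}(W_{n-r})\},$$ i.e. the network achieves $\epsilon$-bounded convergence with $\epsilon=\bar\epsilon$.
   Context: **Notation.** $\mathbb R^+=[0,+\infty)$. $\|\cdot\|_2$ is the Euclidean norm. $\lambda_{\max}(M)$ is the largest eigenvalue of $M$. $I_n$ is the identity. The subscript $r$ on a diagonal matrix denotes its $r\times r$ upper-left block and $n-r$ its $(n-r)\times(n-r)$ lower-right block (terms and conditions involving an empty block are omitted). **Piecewise smooth (PWS) vector fields.** $f:\mathbb R^+\times\mathbb R^n\to\mathbb R^n$ is PWS if there are finitely many disjoint open nonempty sets $\mathcal S_1,\dots,\mathcal S_p$ whose closures cover $\mathbb R^n$, each intersection $\bar{\mathcal S}_h\cap\bar{\mathcal S}_k$ ($h\neq k$) being either an $(n-1)$-dimensional manifold or empty, with $f(t,x)=F_k(t,x)$ for $x\in\mathcal S_k$, where each $F_k$ is smooth in $t$ and in $x\in\mathcal S_k$ and is continuously extended to $\partial\mathcal S_k$. The Filippov set-valued map is $$\mathcal F[f](t,x)=\bigcap_{\delta>0}\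 \bigcap_{m(\mathcal S)=0}\overline{\mathrm{co}}\{f(t,B_\delta(x)\setminus\mathcal S)\},$$ with $m(\cdot)$ Lebesgue measure, $B_\delta(x)$ the open ball and $\overline{\mathrm{co}}$ the closed convex hull. If $f$ is continuous at $(t,x)$ then $\mathcal F[f](t,x)=\{f(t,x)\}$. The coupling $\eta$ is continuous or PWS. Solutions of $\dot x=f(t,x)$ are Filippov solutions: absolutely continuous $x(t)$ with $\dot x(t)\in\mathcal F[f](t,x(t))$ for almost all $t$. The network is understood in this sense, as a system in $\mathbb R^{Nn}$. **QUAD.** For $P$ positive definite diagonal and $W$ diagonal, $f$ is QUAD$(P,W)$ if $(x-y)^TP[\tilde f(t,x)-\tilde f(t,y)]\le(x-y)^TW(x-y)$ for all $x,y\in\mathbb R^n$, $t\in\mathbb R^+$, $\tilde f(t,x)\in\mathcal F[f](t,x)$, $\tilde f(t,y)\in\mathcal F[f](t,y)$. $f$ is QUAD$(P,W)$ Affine if $f=h+g$ with $h$ continuous or PWS and QUAD$(P,W)$, and $g$ continuous or PWS such that for some $M<+\infty$, $\|\tilde g(t,x)\|_2<M$ for all $x,t$ and all $\tilde g(t,x)\in\mathcal F[g](t,x)$. **Graph.** $a_{ij}=a_{ji}\ge0$, positive iff $\{i,j\}$ is an edge ($i\ne j$). The Laplacian $L=[\ell_{ij}]$ has $\ell_{ij}=-a_{ij}$ for $i\neq j$ and $\ell_{ii}=\sum_{k\ne i}a_{ik}$. $\lambda_2(L)$ is its smallest nonzero eigenvalue. For a positive definite diagonal matrix $D$, $\lambda_2(L\otimes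 D)$ is the smallest nonzero eigenvalue of $L\otimes D$, i.e. $\lambda_2(L)\min_iD_{ii}$. **$\epsilon$-bounded convergence.** Let $\bar x=\frac1N\sum_jx_j$, $e_i=x_i-\bar x$, $e=[e_1^T,\dots,e_N^T]^T$. The network achieves $\epsilon$-bounded convergence if ''$\lim_{t\to\infty}\|e(t)\|_2\le\epsilon$'' in the sense that (along its trajectories from the given initial condition) for all $\nu>0$ there is $t_\nu>0$ such that $\|e(t)\|_2\le\epsilon+\nu$ for all $t>t_\nu$.
   Formalization: The definition of piecewise smooth additionally requires that the complement of the union of the open sets S_k has Lebesgue measure zero; without this the vector field could be arbitrary on a set of positive measure and the claim can fail. *)

(* Defs.v *)
From mathcomp Require Import all_boot all_order all_algebra.
From mathcomp Require Import all_classical all_reals all_analysis.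
From mathcomp Require Import mxtens.

Set Implicit Arguments.
Unset Strict Implicit.
Unset Printing Implicit Defensive.

Import Order.TTheory GRing.Theory Num.Theory.
Import numFieldNormedType.Exports.

Local Open Scope classical_set_scope.
Local Open Scope ring_scope.

(* Vectors of R^n are row vectors 'rV[R]_n.  The state space R^(Nn) of a
   network of N nodes is 'M[R]_(N, n), row i being the state of node i; the
   generic notions are therefore stated for 'M[R]_(m, n), seen as R^(mn). *)

Section Euclidean.
Variables (R : realType) (m n : nat).

(* The library norm `|v| on matrices is the sup norm. *)
Definition enorm (v : 'M[R]_(m, n)) : R :=
  Num.sqrt (\sum_i \sum_j v i j ^+ 2).

Definition eball (x : 'M[R]_(m, n)) (d : R) : set 'M[R]_(m, n) :=
  [set y | enorm (y - x) < d].

Definition box (a b : 'M[R]_(m, n)) : set 'M[R]_(m, n) :=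
  [set y | forall i j, a i j <= y i j <= b i j].

Definition box_volume (a b : 'M[R]_(m, n)) : R :=
  \prod_i \prod_j (b i j - a i j).

Definition lebesgue_outer (S : set 'M[R]_(m, n)) : \bar R :=
  ereal_inf [set v | exists a b : nat -> 'M[R]_(m, n),
    [/\ forall k i j, a k i j <= b k i j,
        S `<=` \bigcup_k box (a k) (b k) &
        v = (\sum_(0 <= k <oo) (box_volume (a k) (b k))%:E)%E]].

Definition lebesgue_null (S : set 'M[R]_(m, n)) : Prop :=
  lebesgue_outer S = 0%E.

Definition closed_convex_hull (A : set 'M[R]_(m, n)) : set 'M[R]_(m, n) :=
  smallest [set C : set 'M[R]_(m, n) | closed C /\ convex_set C] A.

Definition filippov (f : R -> 'M[R]_(m, n) -> 'M[R]_(m, n)) (t : R)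
    (x : 'M[R]_(m, n)) : set 'M[R]_(m, n) :=
  \bigcap_(d in [set d : R | 0 < d]) \bigcap_(S in @lebesgue_null)
    closed_convex_hull (f t @` (eball x d `\` S)).

Definition abs_continuous_on (a b : R) (x : R -> 'M[R]_(m, n)) : Prop :=
  forall eps : R, 0 < eps -> exists2 delta : R, 0 < delta &
    forall (k : nat) (u v : 'I_k -> R),
      (forall i, [/\ a <= u i, u i <= v i & v i <= b]) ->
      trivIset setT (fun i => `]u i, v i[%classic) ->
      \sum_i (v i - u i) < delta ->
      \sum_i enorm (x (v i) - x (u i)) < eps.

Definition filippov_solution (f : R -> 'M[R]_(m, n) -> 'M[R]_(m, n))
    (x : R -> 'M[R]_(m, n)) : Prop :=
  (forall T : R, 0 < T -> abs_continuous_on 0 T x) /\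
  {ae lebesgue_measure, forall t : R, 0 <= t ->
    derivable x t 1 /\ filippov f t (x t) ('D_1 x t)}.

End Euclidean.

Section PiecewiseSmooth.
Variable R : realType.

Fixpoint Ck_on (V W : normedModType R) (k : nat) (f : V -> W) (U : set V) :
    Prop :=
  if k is k'.+1 then
    (forall x, U x -> differentiable f x) /\
    (forall v : V, Ck_on k' (fun x => 'D_v f x) U)
  else {within U, continuous f}.

Definition smooth_on (V W : normedModType R) (f : V -> W) (U : set V) : Prop :=
  forall k, Ck_on k f U.

Variable n : nat.

Definition half_space (d : nat) : set 'rV[R]_d :=
  [set y | forall i : 'I_d, val i = 0%N -> 0 <= y ord0 i].

(* Topological manifold, possibly with boundary: every point of M has a
   relatively open neighbourhood M `&` U that is homeomorphic to a relatively
   open subset of the closed half-space of R^d. *)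
Definition manifold (d : nat) (M : set 'rV[R]_n) : Prop :=
  forall x, M x -> exists (U : set 'rV[R]_n) (V : set 'rV[R]_d)
      (phi : 'rV[R]_n -> 'rV[R]_d) (psi : 'rV[R]_d -> 'rV[R]_n),
    [/\ open U /\ U x, open V,
        {within M `&` U, continuous phi} /\
        {within @half_space d `&` V, continuous psi},
        (forall y, (M `&` U) y ->
           (@half_space d `&` V) (phi y) /\ psi (phi y) = y) &
        (forall z, (@half_space d `&` V) z ->
           (M `&` U) (psi z) /\ phi (psi z) = z)].

(* The sets S k leave out only the switching manifolds; the last clause makes
   this explicit, since "the closures cover R^n" alone would allow f to be
   arbitrary on, say, a closed nowhere dense set of positive measure.  Smoothness
   on the non-open set [0, +oo[ * S k is smoothness of a local extension. *)
Definition piecewise_smooth (f : R -> 'rV[R]_n -> 'rV[R]_n) : Prop :=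
  exists (p : nat) (S : 'I_p -> set 'rV[R]_n)
      (F : 'I_p -> R * 'rV[R]_n -> 'rV[R]_n),
    [/\ (forall k, open (S k) /\ S k !=set0) /\ trivIset setT S,
        \bigcup_k closure (S k) = setT,
        (forall h k, h != k ->
           closure (S h) `&` closure (S k) = set0 \/
           manifold n.-1 (closure (S h) `&` closure (S k))),
        (forall k,
           [/\ forall t x, 0 <= t -> S k x -> f t x = F k (t, x),
               exists U : set (R * 'rV[R]_n),
                 [/\ open U, [set q | 0 <= q.1 /\ S k q.2] `<=` U &
                     smooth_on (F k) U] &
               {within [set q | 0 <= q.1 /\ closure (S k) q.2],
                 continuous (F k)}]) &
        lebesgue_null (~` \bigcup_k S k)].

Definition continuous_or_pws (f : R -> 'rV[R]_n -> 'rV[R]_n) : Prop :=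
  {within [set q : R * 'rV[R]_n | 0 <= q.1],
    continuous (fun q => f q.1 q.2)} \/
  piecewise_smooth f.

End PiecewiseSmooth.

Section QUAD.
Variables (R : realType) (n : nat).
Implicit Types (P W : 'M[R]_n) (f g h : R -> 'rV[R]_n -> 'rV[R]_n).

(* u^T A v, for u and v given as row vectors *)
Definition bilin (A : 'M[R]_n) (u v : 'rV[R]_n) : R :=
  (u *m A *m v^T) ord0 ord0.

Definition QUAD P W f : Prop :=
  forall (t : R) (x y u v : 'rV[R]_n), 0 <= t ->
    filippov f t x u -> filippov f t y v ->
    bilin P (x - y) (u - v) <= bilin W (x - y) (x - y).

(* f is QUAD(P, W) Affine, as witnessed by the decomposition f = h + g *)
Definition QUAD_affine_with P W f h g : Prop :=
  [/\ forall t x, 0 <= t -> f t x = h t x + g t x,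
      continuous_or_pws h, QUAD P W h, continuous_or_pws g &
      exists M : R, forall t x u, 0 <= t -> filippov g t x u -> enorm u < M].

End QUAD.

Section Spectra.
Variable R : realType.

(* -oo for a 0 * 0 matrix, which is neutral in a maximum *)
Definition lambda_max (n : nat) (A : 'M[R]_n) : \bar R :=
  ereal_sup [set a%:E | a in [set a : R | eigenvalue A a]].

(* +oo if there is no nonzero eigenvalue; for the Laplacian of a connected
   graph, this happens only when the graph is reduced to one node *)
Definition lambda_2 (n : nat) (A : 'M[R]_n) : \bar R :=
  ereal_inf [set a%:E | a in [set a : R | eigenvalue A a /\ a != 0]].

Definition upper_block (n r : nat) (hr : (r <= n)%N) (A : 'M[R]_n) : 'M[R]_r :=
  mxsub (widen_ord hr) (widen_ord hr) A.

Definition lower_block (n r : nat) (hr : (r <= n)%N) (A : 'M[R]_n) :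
    'M[R]_(n - r) :=
  let shift := fun i : 'I_(n - r) => cast_ord (subnKC hr) (rshift r i) in
  mxsub shift shift A.

End Spectra.

Section Network.
Variables (R : realType) (N n : nat).

Definition weighted_graph (A : 'M[R]_N) : Prop :=
  forall i j, A i j = A j i /\ 0 <= A i j.

Definition edge (A : 'M[R]_N) : rel 'I_N :=
  fun i j => (i != j) && (0 < A i j).

Definition connected_graph (A : 'M[R]_N) : Prop :=
  forall i j, connect (edge A) i j.

Definition laplacian (A : 'M[R]_N) : 'M[R]_N :=
  \matrix_(i, j) if i == j then \sum_(k < N | k != i) A i k else - A i j.

Definition network_field (f : 'I_N -> R -> 'rV[R]_n -> 'rV[R]_n) (c : R)
    (A : 'M[R]_N) (eta : R -> 'rV[R]_n -> 'rV[R]_n)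
    (t : R) (X : 'M[R]_(N, n)) : 'M[R]_(N, n) :=
  \matrix_(i < N) (f i t (row i X) -
    c *: \sum_(j < N) A i j *: eta t (row i X - row j X)).

Definition sync_error (X : 'M[R]_(N, n)) : 'M[R]_(N, n) :=
  \matrix_(i < N) (row i X - N%:R^-1 *: \sum_(j < N) row j X).

Definition bounded_convergence (Phi : R -> 'M[R]_(N, n) -> 'M[R]_(N, n))
    (X0 : 'M[R]_(N, n)) (eps : R) : Prop :=
  forall X : R -> 'M[R]_(N, n), filippov_solution Phi X -> X 0 = X0 ->
  forall nu : R, 0 < nu -> exists2 t_nu : R, 0 < t_nu &
    forall t : R, t_nu < t -> enorm (sync_error (X t)) <= eps + nu.

Definition max_bound (hN : (0 < N)%N) (M : 'I_N -> R) : R :=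
  \big[Num.max/M (Ordinal hN)]_(i < N) M i.

End Network.

Section Gains.
Variables (R : realType) (N n r : nat) (hr : (r <= n)%N).
Variables (A : 'M[R]_N) (W Ups : 'M[R]_n) (Mbar : R).
Local Open Scope ereal_scope.

Definition c_tilde (emax : R) : \bar R :=
  maxe ((lambda_2 (laplacian A *t upper_block hr Ups))^-1 *
        ((2 * Num.sqrt N%:R * Mbar / emax)%R%:E +
         lambda_max (upper_block hr W)))
       0.

Definition m_nl (c : R) : \bar R :=
  - maxe (lambda_max (upper_block hr W) -
          c%:E * lambda_2 (laplacian A *t upper_block hr Ups))
         (lambda_max (lower_block hr W)).

(* (+oo)^-1 = 0: the bound is 0 when both terms of the maximum in m_nl are
   omitted (one node and r = n) *)
Definition eps_bar (c : R) : \bar R :=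
  (Mbar * Num.sqrt N%:R)%R%:E / m_nl c.

End Gains.

(* Main.v *)
Require Import Defs.
From mathcomp Require Import all_boot all_order all_algebra.
From mathcomp Require Import all_classical all_reals all_analysis measurable_realfun.
From mathcomp Require Import mxtens ring lra.

(** Write e for the synchronization error of a network state, |e| for its
    Euclidean norm, K = sqrt N * Mbar and m = m_nl.  Along a trajectory, almost
    everywhere and as long as |e| < emax / sqrt 2, the norm satisfies the linear
    differential inequality |e|' <= - m |e| + K, whose equilibrium K / m is the
    announced bound.  The choice of c and condition (ii) give m >= 2 K / emax
    (gains), that is K / m <= emax / 2: hence |e| never leaves the region where
    the inequality is valid, and it decreases to any level above K / m
    (ultimate_bound).

    The inequality comes from the scalar product of e with the network field
    (network_dissipation).  Since e sums to zero over the nodes, the common part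
    h enters only through differences between nodes, where QUAD applies pair by
    pair (sum_ip_le_pairs), and the g_i contribute at most K |e|.  By oddness the
    coupling is a sum over pairs of nodes; these are at distance at most
    sqrt 2 |e| < emax, where the coupling dominates Ups, so it contributes at
    least the Dirichlet forms of the columns of e, weighted by the entries of
    Ups.  The spectral gap of the Laplacian compares them with |e|^2
    (laplacian_gap, lambda_2_tens); in the coordinates where Ups vanishes, the
    entries of W are negative and do the work alone.

    No sum or chain rule for Filippov sets enters.  At almost every network state
    each nonlinearity is evaluated away from its switching set, hence its value
    lies in its own Filippov set and the estimate holds pointwise; and the
    Filippov set of the network at X lies in every closed half-space that
    contains the values of the field at almost all the states near X
    (filippov_dissipation).  This rests on two facts about null sets: pulled back
    along a row or along a difference of two rows they remain null
    (lebesgue_null_row, lebesgue_null_row_sub), and they contain no ball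
    (lebesgue_null_eball).

    The differential inequality holds only for almost every time; it can be
    integrated because |e| is absolutely continuous (ac_nonincreasing).  A network
    with one node is treated apart: its error is zero, and lambda_2 = +oo. *)

Set Implicit Arguments.
Unset Strict Implicit.
Unset Printing Implicit Defensive.

Import Order.TTheory GRing.Theory Num.Theory.
Import numFieldNormedType.Exports.

Local Open Scope classical_set_scope.
Local Open Scope ring_scope.

(** * Lebesgue outer measure *)

Section LebesgueOuter.
Variables (R : realType) (m n : nat).
Implicit Types (a b : 'M[R]_(m, n)) (S : set 'M[R]_(m, n)).

Lemma box_volume_ge0 a b :
  (forall i j, a i j <= b i j) -> 0 <= box_volume a b.
Proof.
by move=> ab; apply: prodr_ge0 => i _; apply: prodr_ge0 => j _; rewrite subr_ge0.
Qed.

Lemma lebesgue_outer_ge0 S : (0 <= lebesgue_outer S)%E.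
Proof.
apply: le_ereal_inf_tmp => _ [a [b [ab _ ->]]].
by apply: nneseries_ge0 => k _ _; rewrite lee_fin box_volume_ge0.
Qed.

Lemma lebesgue_outer_subset S S' :
  S `<=` S' -> (lebesgue_outer S <= lebesgue_outer S')%E.
Proof.
move=> SS'; apply: ereal_inf_le_tmp => _ [a [b [ab S'ab ->]]].
by exists a, b; split => //; exact: subset_trans SS' S'ab.
Qed.

Lemma lebesgue_outer_box a b : (0 < m)%N -> (0 < n)%N ->
  (forall i j, a i j <= b i j) ->
  (lebesgue_outer (box a b) <= (box_volume a b)%:E)%E.
Proof.
move=> m0 n0 ab; apply: ereal_inf_lbound.
(* every box of the sequence but the first is reduced to the point a *)
exists (fun=> a), (fun k => if k is 0%N then b else a); split.
- by case.
- by move=> y yab; exists 0%N.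
- rewrite (nneseries_split 0 1) => [|[|k] _] //; last 2 first.
  + by rewrite lee_fin box_volume_ge0.
  + by rewrite lee_fin box_volume_ge0.
  rewrite big_nat1 eseries0 ?adde0// => -[|k] //= _ _.
  rewrite /box_volume (bigD1 (Ordinal m0))//= (bigD1 (Ordinal n0))//=.
  by rewrite subrr !mul0r.
Qed.

Lemma lebesgue_outer_cover S (e : R) : (lebesgue_outer S < +oo)%E -> 0 < e ->
  exists B : nat -> 'M[R]_(m, n) * 'M[R]_(m, n),
    [/\ forall k i j, (B k).1 i j <= (B k).2 i j,
        S `<=` \bigcup_k box (B k).1 (B k).2 &
        (\sum_(0 <= k <oo) (box_volume (B k).1 (B k).2)%:E
           <= lebesgue_outer S + e%:E)%E].
Proof.
move=> Soo e0.
have Sfin : lebesgue_outer S \is a fin_num.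
  by rewrite ge0_fin_numE ?lebesgue_outer_ge0.
have [_ [a [b [ab Sab ->]]] lte] := lb_ereal_inf_adherent e0 Sfin.
by exists (fun k => (a k, b k)); split => //; exact: ltW.
Qed.

(** Near-optimal covers of all the sets are merged into one sequence of boxes
    along a bijection between nat * nat and nat; the k-th cover may exceed the
    optimum by e / 2 ^ (k + 1). *)
Lemma lebesgue_outer_bigcup (S : nat -> set 'M[R]_(m, n)) :
  (lebesgue_outer (\bigcup_k S k) <= \sum_(0 <= k <oo) lebesgue_outer (S k))%E.
Proof.
have [[i ioo]|] := pselect (exists k, lebesgue_outer (S k) = +oo%E).
  rewrite (eseries_pinfty _ _ ioo) ?leey// => k _.
  by rewrite -ltNye (lt_le_trans _ (lebesgue_outer_ge0 _)).
move=> /forallNP Soo; apply/lee_addgt0Pr => e e0.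
apply: le_trans (epsilon_trick _ _ (ltW e0)); last first.
  by move=> k; exact: lebesgue_outer_ge0.
have en k : 0 < e / (2 ^ k.+1)%:R by rewrite divr_gt0.
have Sk k : (lebesgue_outer (S k) < +oo)%E by rewrite ltey; apply/eqP/Soo.
have [B PB] := choice (fun k => lebesgue_outer_cover (Sk k) (en k)).
pose vol (p : nat * nat) := (box_volume (B p.1 p.2).1 (B p.1 p.2).2)%:E.
have vol0 p : (0 <= vol p)%E by rewrite lee_fin box_volume_ge0//; case: (PB p.1).
have /card_esym/ppcard_eqP[f] := card_nat2.
apply: (@le_trans _ _ (\sum_(0 <= i <oo) vol (f i))%E).
  apply: ereal_inf_lbound.
  exists (fun i => (B (f i).1 (f i).2).1), (fun i => (B (f i).1 (f i).2).2).
  split=> // [k i j|y [k _ Sky]]; first by case: (PB (f k).1).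
  have [_ /(_ _ Sky)[l _ yB] _] := PB k.
  by exists (f^-1%FUN (k, l)) => //; rewrite invK ?inE.
rewrite nneseries_esumT//.
rewrite -(reindex_esum [set: nat] [set: nat * nat] f vol)//.
rewrite (_ : [set: nat * nat] = [set: nat] `*`` (fun=> [set: nat])); last first.
  by apply/seteqP; split.
rewrite -(esum_esum (a := fun i j => vol (i, j)))//.
rewrite -nneseries_esumT//; last by move=> k; exact: esum_ge0.
apply: lee_nneseries => k _; first by move=> _; exact: esum_ge0.
by rewrite -nneseries_esumT//; case: (PB k).
Qed.

Lemma lebesgue_null_subset S S' :
  S `<=` S' -> lebesgue_null S' -> lebesgue_null S.
Proof.
move=> /lebesgue_outer_subset SS' S'0; apply/eqP; rewrite eq_le.
by rewrite lebesgue_outer_ge0 andbT (le_trans SS')// S'0.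
Qed.

Lemma lebesgue_null_bigcup (S : nat -> set 'M[R]_(m, n)) :
  (forall k, lebesgue_null (S k)) -> lebesgue_null (\bigcup_k S k).
Proof.
move=> S0; apply/eqP; rewrite eq_le lebesgue_outer_ge0 andbT.
by apply: le_trans (lebesgue_outer_bigcup _) _; rewrite eseries0// => k _ _; exact: S0.
Qed.

Lemma lebesgue_null0 : (0 < m)%N -> (0 < n)%N ->
  lebesgue_null (@set0 'M[R]_(m, n)).
Proof.
move=> m0 n0; apply/eqP; rewrite eq_le lebesgue_outer_ge0 andbT.
apply: le_trans (lebesgue_outer_subset (sub0set (box 0 0))) _.
apply: le_trans (lebesgue_outer_box _ _ _) _ => //.
by rewrite /box_volume (bigD1 (Ordinal m0))//= (bigD1 (Ordinal n0))//= subrr !mul0r.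
Qed.

Lemma lebesgue_null_finite_bigcup (I : finType) (S : I -> set 'M[R]_(m, n)) :
  (0 < m)%N -> (0 < n)%N ->
  (forall i, lebesgue_null (S i)) -> lebesgue_null (\bigcup_i S i).
Proof.
move=> m0 n0 S0.
pose S' k := if [pick i : I | enum_rank i == k :> nat] is Some i then S i else set0.
apply: (@lebesgue_null_subset _ (\bigcup_k S' k)).
  move=> y [i _ Siy]; exists (enum_rank i) => //; rewrite /S'.
  case: pickP => [j /eqP/val_inj/enum_rank_inj -> //|/(_ i)].
  by rewrite eqxx.
by apply: lebesgue_null_bigcup => k; rewrite /S'; case: pickP => // _; exact: lebesgue_null0.
Qed.

Lemma lebesgue_null_setU S S' : (0 < m)%N -> (0 < n)%N ->
  lebesgue_null S -> lebesgue_null S' -> lebesgue_null (S `|` S').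
Proof.
move=> m0 n0 S0 S'0.
pose F i := if i then S else S'; apply: (@lebesgue_null_subset _ (\bigcup_i F i)).
  by move=> y [Sy|S'y]; [exists true|exists false].
by apply: lebesgue_null_finite_bigcup => // -[].
Qed.

Lemma lebesgue_outer_finite_bigcup (J : nat) (S : nat -> set 'M[R]_(m, n)) :
  (0 < m)%N -> (0 < n)%N ->
  (lebesgue_outer (\bigcup_(k in [set k | (k < J)%N]) S k)
     <= \sum_(k < J) lebesgue_outer (S k))%E.
Proof.
move=> m0 n0.
pose S' k := if (k < J)%N then S k else set0.
apply: (@le_trans _ _ (lebesgue_outer (\bigcup_k S' k))).
  apply: lebesgue_outer_subset => y [k kJ Sky]; exists k => //.
  by rewrite /S' (kJ : (k < J)%N).
apply: le_trans (lebesgue_outer_bigcup _) _.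
rewrite (nneseries_split 0 J); last by move=> k _; exact: lebesgue_outer_ge0.
rewrite add0n big_mkord eseries0 ?adde0; last first.
  move=> k Jk _; rewrite /S' ltnNge Jk/=; exact: lebesgue_null0.
by apply: lee_sum => k _; rewrite /S' ltn_ord.
Qed.

End LebesgueOuter.

(** * Preimages and interior of null sets *)

Lemma coord_le_norm (R : realType) (m n : nat) (v : 'M[R]_(m, n)) i j :
  `|v i j| <= `|v|.
Proof.
rewrite [leRHS]/Num.Def.normr/= mx_normrE.
exact: (le_bigmax _ (fun ij : 'I_m * 'I_n => `|v ij.1 ij.2|) (i, j)).
Qed.

(** If preimages of boxes cost at most C times the volume of the box, so do
    preimages of covers.  The set Q localizes the estimate: the preimage of a box
    under a coordinate projection is unbounded. *)
Lemma lebesgue_null_preimage (R : realType) (m n p q : nat)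
    (phi : 'M[R]_(p, q) -> 'M[R]_(m, n)) (Q : set 'M[R]_(p, q)) (C : R)
    (S : set 'M[R]_(m, n)) :
  0 <= C ->
  (forall a b : 'M[R]_(m, n), (forall i j, a i j <= b i j) ->
     (lebesgue_outer (Q `&` phi @^-1` box a b) <= (C * box_volume a b)%:E)%E) ->
  lebesgue_null S -> lebesgue_null (Q `&` phi @^-1` S).
Proof.
move=> C0 outerC S0; apply/eqP; rewrite eq_le lebesgue_outer_ge0 andbT.
apply/lee_addgt0Pr => e e0; rewrite add0e.
have eC : 0 < e / (C + 1) by rewrite divr_gt0// ltr_wpDl.
have [|B [Bab SB BS]] := @lebesgue_outer_cover _ _ _ S _ _ eC.
  by rewrite (S0 : lebesgue_outer S = 0%E) ltry.
rewrite (S0 : lebesgue_outer S = 0%E) add0e in BS.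
pose T k := Q `&` phi @^-1` box (B k).1 (B k).2.
apply: (@le_trans _ _ (lebesgue_outer (\bigcup_k T k))).
  by apply: lebesgue_outer_subset => y [Qy /SB[k _ yk]]; exists k.
apply: le_trans (lebesgue_outer_bigcup _) _.
apply: (@le_trans _ _ (\sum_(0 <= k <oo)
    (C%:E * (box_volume (B k).1 (B k).2)%:E))%E).
  apply: lee_nneseries => k _; first by move=> _; exact: lebesgue_outer_ge0.
  by rewrite -EFinM; apply: outerC.
rewrite nneseriesZl; last by move=> k _; rewrite lee_fin box_volume_ge0.
apply: (@le_trans _ _ (C%:E * (e / (C + 1))%:E)%E).
  by apply: lee_wpmul2l => //; rewrite lee_fin.
rewrite -EFinM lee_fin mulrCA -[leRHS]mulr1 ler_pM2l//.
by rewrite ler_pdivrMr ?mul1r ?lerDl// ltr_wpDl.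
Qed.

(** The preimage of a box of R^n is the product of that box with all the other
    coordinates; cutting these off at K makes it a box. *)
Lemma lebesgue_null_row (R : realType) (m n : nat) (i : 'I_m)
    (S : set 'rV[R]_n) : (0 < n)%N ->
  lebesgue_null S -> lebesgue_null [set Y : 'M[R]_(m, n) | S (row i Y)].
Proof.
move=> n0 S0; have m0 : (0 < m)%N by apply: leq_ltn_trans (ltn_ord i).
pose Q (K : nat) : set 'M[R]_(m, n) := [set Y | forall k l, `|Y k l| <= K%:R].
apply: (@lebesgue_null_subset _ _ _ _ (\bigcup_K (Q K `&` row i @^-1` S))).
  move=> Y SY; exists (Num.bound `|Y|) => //; split => // k l.
  exact: le_trans (coord_le_norm _ _ _) (ltW (archi_boundP _)).
apply: lebesgue_null_bigcup => K.
pose C : R := \prod_(k < m | k != i) \prod_(l < n) (K%:R - - K%:R).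
apply: (@lebesgue_null_preimage _ _ _ _ _ _ _ C) => //.
  apply: prodr_ge0 => k _; apply: prodr_ge0 => l _.
  by rewrite opprK addr_ge0.
move=> a b ab.
pose a' : 'M[R]_(m, n) := \matrix_(k, l) if k == i then a ord0 l else - K%:R.
pose b' : 'M[R]_(m, n) := \matrix_(k, l) if k == i then b ord0 l else K%:R.
apply: (@le_trans _ _ (lebesgue_outer (box a' b'))).
  apply: lebesgue_outer_subset => Y [QY Yab] k l; rewrite !mxE.
  case: eqP => [->|_]; first by have := Yab ord0 l; rewrite mxE.
  by rewrite -ler_norml; exact: QY.
apply: le_trans (lebesgue_outer_box m0 n0 _) _.
  move=> k l; rewrite !mxE; case: eqP => [_|_]; first exact: ab.
  by rewrite lerNl -subr_ge0 opprK addr_ge0.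
rewrite lee_fin /box_volume (bigD1 i)//= mulrC big_ord1; rewrite le_eqVlt; apply/predU1P; left.
congr (_ * _).
  apply: eq_bigr => k /negbTE ki; apply: eq_bigr => l _.
  by rewrite !mxE ki.
by apply: eq_bigr => l _; rewrite !mxE eqxx.
Qed.

Lemma grid_cell (R : realType) (J : nat) (a tau q : R) : (0 < J)%N ->
  a <= q <= a + J%:R * tau ->
  exists2 k, (k < J)%N & a + k%:R * tau <= q <= a + (k.+1)%:R * tau.
Proof.
elim: J => // J IHJ _ /andP[aq qJ].
case: (posnP J) => [J0|J0].
  by exists 0%N => //; rewrite mul0r addr0 aq -J0.
have [qJ'|/ltW qJ'] := leP q (a + J%:R * tau).
  have [|k kJ kq] := IHJ J0; first by rewrite aq.
  by exists k => //; exact: ltnW.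
by exists J => //; rewrite qJ'.
Qed.

(** A shear in one coordinate maps a box to a parallelepiped.  Cutting it into
    J slices across the direction of the shear, and putting each slice into a
    box, costs a volume that tends to that of the original box. *)
Lemma lebesgue_outer_shear (R : realType) (m n : nat) (i1 i2 : 'I_m) (l : 'I_n)
    (a b : 'M[R]_(m, n)) : i1 != i2 -> (forall i j, a i j <= b i j) ->
  (lebesgue_outer
     [set Y : 'M[R]_(m, n) | box a b (Y - Y i2 l *: delta_mx i1 l)%R]
   <= (box_volume a b)%:E)%E.
Proof.
move=> i12 ab.
have m0 : (0 < m)%N by apply: leq_ltn_trans (ltn_ord i1).
have n0 : (0 < n)%N by apply: leq_ltn_trans (ltn_ord l).
have p21 : (i2, l) != (i1, l) by rewrite xpair_eqE eqxx andbT eq_sym.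
have volE a' b' : box_volume a' b' = (b' i1 l - a' i1 l) *
    ((b' i2 l - a' i2 l) * \prod_(p : 'I_m * 'I_n |
        (p != (i1, l)) && (p != (i2, l))) (b' p.1 p.2 - a' p.1 p.2)) :> R.
  by rewrite /box_volume pair_bigA/= (bigD1 (i1, l))//= (bigD1 (i2, l)).
pose v1 := b i1 l - a i1 l; pose v2 := b i2 l - a i2 l.
pose P := \prod_(p : 'I_m * 'I_n | (p != (i1, l)) && (p != (i2, l)))
  (b p.1 p.2 - a p.1 p.2).
have v10 : 0 <= v1 by rewrite subr_ge0.
have v20 : 0 <= v2 by rewrite subr_ge0.
have P0 : 0 <= P by apply: prodr_ge0 => p _; rewrite subr_ge0.
apply/lee_addgt0Pr => e e0.
pose D := v2 ^+ 2 * P / e.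
have D0 : 0 <= D by rewrite divr_ge0 ?mulr_ge0 ?sqr_ge0// ltW.
pose J := (Num.bound D).+1; pose tau := v2 / J%:R.
have J0 : 0 < J%:R :> R by rewrite ltr0n.
have tau0 : 0 <= tau by rewrite divr_ge0// ltW.
have Jtau : J%:R * tau = v2 by rewrite /tau mulrC divfK// gt_eqF.
pose ak (k : nat) : 'M[R]_(m, n) := \matrix_(i, j)
  if (i, j) == (i1, l) then a i1 l + (a i2 l + k%:R * tau) else
  if (i, j) == (i2, l) then a i2 l + k%:R * tau else a i j.
pose bk (k : nat) : 'M[R]_(m, n) := \matrix_(i, j)
  if (i, j) == (i1, l) then b i1 l + (a i2 l + (k.+1)%:R * tau) else
  if (i, j) == (i2, l) then a i2 l + (k.+1)%:R * tau else b i j.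
have tauS (k : nat) : k%:R * tau <= (k.+1)%:R * tau by rewrite ler_wpM2r// ler_nat.
apply: (@le_trans _ _
    (lebesgue_outer (\bigcup_(k in [set k | (k < J)%N]) box (ak k) (bk k)))).
  apply: lebesgue_outer_subset => Y /= Yab.
  have Y2 : a i2 l <= Y i2 l <= a i2 l + J%:R * tau.
    have := Yab i2 l; rewrite !mxE eq_sym (negbTE i12)/= mulr0 subr0.
    by rewrite Jtau addrC subrK.
  have [//|k kJ /andP[k1 k2]] := grid_cell _ Y2; exists k => // i j; rewrite !mxE.
  case: eqP => [[-> ->]|/eqP ij1].
    have := Yab i1 l; rewrite !mxE !eqxx/= mulr1 => /andP[h1 h2].
    by apply/andP; split; lra.
  case: eqP => [[-> ->]|ij2]; first by rewrite k1.
  by have := Yab i j; rewrite !mxE -xpair_eqE (negbTE ij1) mulr0 subr0.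
apply: le_trans (lebesgue_outer_finite_bigcup _ _ m0 n0) _.
have volk k : (lebesgue_outer (box (ak k) (bk k)) <=
    ((v1 + tau) * (tau * P))%:E)%E.
  apply: (@le_trans _ _ (box_volume (ak k) (bk k))%:E).
    apply: lebesgue_outer_box => // i j; rewrite !mxE.
    case: ifP => _; first by rewrite lerD// lerD2l.
    by case: ifP => _ //; rewrite lerD2l.
  rewrite lee_fin volE !mxE !eqxx (negbTE p21); rewrite le_eqVlt; apply/predU1P; left.
  congr (_ * (_ * _)).
  - by rewrite /v1 -[k.+1]addn1 natrD; ring.
  - by rewrite -[k.+1]addn1 natrD; ring.
  - by apply: eq_bigr => -[i j] /andP[/negbTE ij1 /negbTE ij2]; rewrite !mxE ij1 ij2.
apply: (@le_trans _ _ (\sum_(k < J) ((v1 + tau) * (tau * P))%:E)%E).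
  by apply: lee_sum => k _; exact: volk.
rewrite sumEFin big_const_ord iter_addr_0 -EFinD lee_fin volE -/v1 -/v2 -/P.
rewrite -mulr_natl.
have -> : J%:R * ((v1 + tau) * (tau * P)) = (v1 + tau) * ((J%:R * tau) * P) by ring.
rewrite Jtau mulrDl lerD2l.
have -> : tau * (v2 * P) = v2 ^+ 2 * P / J%:R by rewrite /tau; field; rewrite gt_eqF.
rewrite ler_pdivrMr// [e * _]mulrC -ler_pdivrMr//.
by apply: le_trans (ltW (archi_boundP D0)) _; rewrite ler_nat.
Qed.

Lemma lebesgue_null_shear (R : realType) (m n : nat) (i1 i2 : 'I_m) (l : 'I_n)
    (S : set 'M[R]_(m, n)) : i1 != i2 -> lebesgue_null S ->
  lebesgue_null [set Y : 'M[R]_(m, n) | S (Y - Y i2 l *: delta_mx i1 l)].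
Proof.
move=> i12 S0; pose phi (Y : 'M[R]_(m, n)) := Y - Y i2 l *: delta_mx i1 l.
rewrite -[X in lebesgue_null X](setTI (phi @^-1` S)).
apply: (@lebesgue_null_preimage _ _ _ _ _ _ _ 1) => // a b ab.
by rewrite setTI mul1r; exact: lebesgue_outer_shear.
Qed.

(** The map Y |-> row i1 Y - row i2 Y is the projection onto row i1 after n
    elementary shears. *)
Lemma lebesgue_null_row_sub (R : realType) (m n : nat) (i1 i2 : 'I_m)
    (S : set 'rV[R]_n) : (0 < n)%N -> i1 != i2 -> lebesgue_null S ->
  lebesgue_null [set Y : 'M[R]_(m, n) | S (row i1 Y - row i2 Y)].
Proof.
move=> n0 i12 S0.
(* one elementary shear for each column *)
suff null_partial (s : seq 'I_n) : lebesgue_null [set Y : 'M[R]_(m, n) |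
    S (row i1 Y - \sum_(l <- s) Y i2 l *: delta_mx 0 l)].
  have := null_partial (index_enum 'I_n); apply: lebesgue_null_subset => Y /=.
  suff -> : row i2 Y = \sum_l Y i2 l *: delta_mx 0 l by [].
  by rewrite [LHS]row_sum_delta; apply: eq_bigr => l _; rewrite mxE.
elim: s => [|l s IHs].
  have := lebesgue_null_row i1 n0 S0; apply: lebesgue_null_subset => Y /=.
  by rewrite big_nil subr0.
have := lebesgue_null_shear l i12 IHs; apply: lebesgue_null_subset => Y /=.
set Y' := Y - _; have -> : \sum_(k <- s) Y' i2 k *: delta_mx 0 k =
    \sum_(k <- s) Y i2 k *: delta_mx 0 k :> 'rV_n.
  apply: eq_bigr => k _; congr (_ *: _).
  by rewrite !mxE eq_sym (negbTE i12) mulr0 subr0.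
rewrite big_cons opprD addrA; congr (S (_ - _)).
by apply/rowP => k; rewrite !mxE !eqxx.
Qed.

(** By Tonelli, one coordinate at a time: for each value of the first
    coordinate, the boxes that meet the corresponding slice cover it.  The
    predicate K selects these boxes, so that the family stays indexed by nat. *)
Lemma box_content_le_cover (R : realType) (I : finType) (s : seq I)
    (p q : I -> R) (a b : nat -> I -> R) (K : pred nat) :
  uniq s -> (forall i, p i <= q i) -> (forall k i, a k i <= b k i) ->
  (forall x : I -> R, (forall i, p i <= x i <= q i) ->
     exists2 k, K k & forall i, i \in s -> a k i <= x i <= b k i) ->
  ((\prod_(i <- s) (q i - p i))%:E <=
     \sum_(0 <= k <oo) ((K k)%:R * \prod_(i <- s) (b k i - a k i))%:E)%E.
Proof.
move=> us pq ab; elim: s us K => [_|i s IHs /= /andP[iNs us]] K cov.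
  have [k Kk _] : exists2 k, K k & forall i, i \in [::] -> a k i <= p i <= b k i.
    by apply: cov => i; rewrite lexx pq.
  rewrite (nneseries_split 0 k.+1); last by move=> j _; rewrite big_nil mulr1 lee_fin.
  rewrite add0n big_nat_recr//= Kk !big_nil mulr1 -[leLHS]add0e -addeA.
  apply: leeD; first by apply: sume_ge0 => j _; rewrite big_nil mulr1 lee_fin.
  rewrite leeDl//; apply: nneseries_ge0 => j _ _.
  by rewrite big_nil mulr1 lee_fin.
pose w k := (K k)%:R * \prod_(j <- s) (b k j - a k j).
have w0 k : 0 <= w k.
  by rewrite mulr_ge0//; apply: prodr_ge0 => j _; rewrite subr_ge0.
pose g k (x : measurableTypeR R) : \bar R := ((w k)%:E * (\1_(`[a k i, b k i]%classic) x)%:E)%E.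
pose mu : {measure set (measurableTypeR R) -> \bar R} := @lebesgue_measure R.
have g0 k x : (0 <= g k x)%E by rewrite /g -EFinM lee_fin mulr_ge0.
have mg k : measurable_fun [set: measurableTypeR R] (g k).
  apply: measurable_funeM; apply/measurable_EFinP; exact: measurable_indic.
have slice (x : R) : `[p i, q i]%classic x ->
    ((\prod_(j <- s) (q j - p j))%:E <= \sum_(0 <= k <oo) g k x)%E.
  rewrite /= in_itv/= => xpq.
  apply: le_trans (IHs us (fun k => K k && (a k i <= x <= b k i)) _) _.
    move=> y ypq; pose y' j := if j == i then x else y j.
    have [|k Kk kab] := cov y'.
      by move=> j; rewrite /y'; case: eqP => [->|_].
    exists k; first by have := kab i (mem_head _ _); rewrite Kk /y' eqxx.
    move=> j js; have := kab j; rewrite inE js orbT /y' => /(_ isT).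
    by case: eqP => // ji; rewrite -ji js in iNs.
  apply: lee_nneseries => k _.
    move=> _; rewrite lee_fin mulr_ge0//.
    by apply: prodr_ge0 => j _; rewrite subr_ge0.
  rewrite /g -EFinM lee_fin indicE mem_setE in_itv/= /w.
  by rewrite mulrAC -natrM mulnb.
rewrite big_cons.
have -> : ((q i - p i) * \prod_(j <- s) (q j - p j))%:E =
    (\int[mu]_(x in `[p i, q i]) (cst (\prod_(j <- s) (q j - p j))%:E x))%E.
  rewrite integral_cst//= lebesgue_measure_itv/= lte_fin.
  have := pq i; rewrite le_eqVlt => /predU1P[->|->].
    by rewrite ltxx subrr mul0r mule0.
  by rewrite -EFinB -EFinM mulrC.
apply: (@le_trans _ _ (\int[mu]_(x in `[p i, q i]) (\sum_(0 <= k <oo) g k x))%E).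
  apply: ge0_le_integral => //=.
  - move=> x _; rewrite lee_fin; apply: prodr_ge0 => j _.
    by rewrite subr_ge0.
  - apply: (measurable_funS measurableT) => //.
    exact: (@ge0_emeasurable_sum _ _ _ _ g xpredT).
rewrite integral_nneseries//; last first.
  by move=> k; apply: (measurable_funS measurableT).
apply: lee_nneseries => k _; first by move=> _; exact: integral_ge0.
rewrite /g ge0_integralZl_EFin//; last first.
  by apply/measurable_EFinP; exact: measurable_indic.
rewrite integral_indic// big_cons mulrCA [leRHS]EFinM muleC.
apply: lee_pmul => //; first by rewrite lee_fin.
apply: le_trans (le_measure mu _ _ (@subIsetl _ _ _)) _; rewrite ?inE//.
  exact: measurableI.
rewrite /= lebesgue_measure_itv/= lte_fin; case: ifP => _ //.
by rewrite lee_fin subr_ge0.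
Qed.

Lemma coord_le_enorm (R : realType) (m n : nat) (v : 'M[R]_(m, n)) i j :
  `|v i j| <= enorm v.
Proof.
rewrite -sqrtr_sqr ler_wsqrtr// (bigD1 i)//= (bigD1 j)//= -addrA lerDl.
apply: addr_ge0; first by apply: sumr_ge0 => l _; exact: sqr_ge0.
by apply: sumr_ge0 => k _; apply: sumr_ge0 => l _; exact: sqr_ge0.
Qed.

Lemma norm_le_enorm (R : realType) (m n : nat) (v : 'M[R]_(m, n)) :
  `|v| <= enorm v.
Proof.
rewrite [leLHS]/Num.Def.normr/= mx_normrE; apply: bigmax_le => [|[i j] _ /=].
  exact: sqrtr_ge0.
exact: coord_le_enorm.
Qed.

Lemma enorm_le_coord (R : realType) (m n : nat) (v : 'M[R]_(m, n)) (d : R) :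
  0 <= d -> (forall i j, `|v i j| <= d) -> enorm v <= (m * n)%:R * d.
Proof.
move=> d0 vd; rewrite -[leRHS]ger0_norm ?mulr_ge0//.
rewrite -sqrtr_sqr ler_wsqrtr//.
apply: (@le_trans _ _ (\sum_(i < m) \sum_(j < n) d ^+ 2)).
  by apply: ler_sum => i _; apply: ler_sum => j _; rewrite -real_normK ?num_real// ler_sqr ?nnegrE.
under eq_bigr => i _ do rewrite sumr_const card_ord.
rewrite sumr_const card_ord -mulrnA -[leLHS]mulr_natl exprMn ler_wpM2r ?sqr_ge0//.
by rewrite -natrX mulnC ler_nat; case: (m * n)%N => // k; rewrite leq_pmulr.
Qed.

Lemma nbhs_eball (R : realType) (m n : nat) (x : 'M[R]_(m, n)) (d : R) :
  0 < d -> \forall y \near x, eball x d y.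
Proof.
move=> d0; pose e := d / ((m * n)%:R + 1).
have mn0 : 0 < (m * n)%:R + 1 :> R by rewrite ltr_wpDl.
have e0 : 0 < e by rewrite divr_gt0.
apply/nbhs_ballP; exists e => // y; rewrite -ball_normE/= => xy.
apply: (@le_lt_trans _ _ ((m * n)%:R * e)).
  apply: enorm_le_coord; first exact: ltW.
  by move=> i j; apply: le_trans (coord_le_norm _ _ _) _; rewrite distrC ltW.
by rewrite /e mulrA ltr_pdivrMr// mulrC ltr_pM2l// ltrDl.
Qed.

Lemma eball_nbhs (R : realType) (m n : nat) (x : 'M[R]_(m, n)) (P : set _) :
  (\forall y \near x, P y) -> exists2 d : R, 0 < d & eball x d `<=` P.
Proof.
move=> /nbhs_ballP[d /= d0 dP]; exists d => // y xy; apply: dP.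
by rewrite -ball_normE/= distrC; apply: le_lt_trans (norm_le_enorm _) xy.
Qed.

(** A null set has empty interior: a cube inside the ball has positive content,
    hence no cover of arbitrarily small total volume. *)
Lemma lebesgue_null_eball (R : realType) (m n : nat) (x : 'M[R]_(m, n)) (d : R)
    (S : set 'M[R]_(m, n)) :
  0 < d -> lebesgue_null S -> (eball x d `\` S) !=set0.
Proof.
move=> d0 S0; apply/set0P/eqP => eS.
have {eS} dS : eball x d `<=` S.
  move=> y xy; apply: contrapT => Sy.
  by have : (eball x d `\` S) y by []; rewrite eS.
pose e := d / ((m * n)%:R + 1).
have mn0 : 0 < (m * n)%:R + 1 :> R by rewrite ltr_wpDl.
have e0 : 0 < e by rewrite divr_gt0.
pose V : R := \prod_(i : 'I_m * 'I_n) ((x i.1 i.2 + e) - (x i.1 i.2 - e)).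
have V0 : 0 < V.
  by apply: prodr_gt0 => i _; rewrite subr_gt0 ltrD2l gtrN.
have Soo : (lebesgue_outer S < +oo)%E.
  by rewrite (S0 : lebesgue_outer S = 0%E) ltry.
have [B [Bab SB]] := lebesgue_outer_cover Soo (divr_gt0 V0 (ltr0Sn R 1)).
rewrite (S0 : lebesgue_outer S = 0%E) add0e; apply/negP; rewrite -ltNge.
apply: (@lt_le_trans _ _ V%:E).
  by rewrite lte_fin ltr_pdivrMr// ltr_pMr// ltr1n.
have := @box_content_le_cover R _ (index_enum ('I_m * 'I_n)%type)
  (fun i => x i.1 i.2 - e) (fun i => x i.1 i.2 + e)
  (fun k i => (B k).1 i.1 i.2) (fun k i => (B k).2 i.1 i.2) xpredT.
rewrite index_enum_uniq => /(_ isT) /=.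
under eq_eseriesr => k _ do rewrite mul1r -(pair_bigA _ (fun i j => (B k).2 i j - (B k).1 i j))/=.
apply => [i|k i|y ye]; first by rewrite lerD2l (le_trans _ (ltW e0))// oppr_le0 ltW.
  exact: Bab.
pose Y : 'M[R]_(m, n) := \matrix_(i, j) y (i, j).
have [k _ Yk] : (\bigcup_k box (B k).1 (B k).2) Y.
  apply: SB; apply: dS; rewrite /eball /=.
  apply: (@le_lt_trans _ _ ((m * n)%:R * e)).
    apply: enorm_le_coord => [|i j]; first exact: ltW.
    by rewrite !mxE ler_distl; have := ye (i, j).
  by rewrite /e mulrA ltr_pdivrMr// mulrC ltr_pM2l// ltrDl.
by exists k => // -[i j] _; have := Yk i j; rewrite mxE.
Qed.

(** * Euclidean inner product *)

Section InnerProduct.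
Variables (R : realType) (m n : nat).
Implicit Types (u v w : 'M[R]_(m, n)).

Definition ip u v : R := \sum_i \sum_j u i j * v i j.

Lemma ipC u v : ip u v = ip v u.
Proof. by apply: eq_bigr => i _; apply: eq_bigr => j _; rewrite mulrC. Qed.

Lemma ipDr u v w : ip u (v + w) = ip u v + ip u w.
Proof.
rewrite -big_split; apply: eq_bigr => i _; rewrite -big_split.
by apply: eq_bigr => j _; rewrite mxE mulrDr.
Qed.

Lemma ipZr a u v : ip u (a *: v) = a * ip u v.
Proof.
rewrite mulr_sumr; apply: eq_bigr => i _; rewrite mulr_sumr.
by apply: eq_bigr => j _; rewrite mxE mulrCA.
Qed.

Lemma ipNr u v : ip u (- v) = - ip u v.
Proof. by rewrite -scaleN1r ipZr mulN1r. Qed.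

Lemma ipBr u v w : ip u (v - w) = ip u v - ip u w.
Proof. by rewrite ipDr ipNr. Qed.

Lemma ipDl u v w : ip (u + v) w = ip u w + ip v w.
Proof. by rewrite ipC ipDr !(ipC w). Qed.

Lemma ipZl a u v : ip (a *: u) v = a * ip u v.
Proof. by rewrite ipC ipZr ipC. Qed.

Lemma ipBl u v w : ip (u - v) w = ip u w - ip v w.
Proof. by rewrite ipC ipBr !(ipC w). Qed.

Lemma ip_ge0 u : 0 <= ip u u.
Proof. by apply: sumr_ge0 => i _; apply: sumr_ge0 => j _; rewrite -expr2 sqr_ge0. Qed.

Lemma enorm_sqr u : enorm u ^+ 2 = ip u u.
Proof.
rewrite sqr_sqrtr; first by apply: eq_bigr => i _; apply: eq_bigr => j _.
by apply: sumr_ge0 => i _; apply: sumr_ge0 => j _; rewrite sqr_ge0.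
Qed.

Lemma enorm_ge0 u : 0 <= enorm u. Proof. exact: sqrtr_ge0. Qed.

Lemma enorm0_eq0 u : enorm u = 0 -> u = 0.
Proof.
move=> u0; apply/matrixP => i j; rewrite mxE; apply/eqP.
by rewrite -normr_le0 -u0 coord_le_enorm.
Qed.

Lemma ip0_eq0 u : ip u u = 0 -> u = 0.
Proof. by move=> /eqP; rewrite -enorm_sqr sqrf_eq0 => /eqP/enorm0_eq0. Qed.

Lemma ip0l v : ip 0 v = 0.
Proof. by rewrite -(scale0r v) ipZl mul0r. Qed.

Lemma ip_le_enorm u v : ip u v <= enorm u * enorm v.
Proof.
have [u0|u0] := eqVneq (enorm u) 0.
  rewrite u0 mul0r le_eqVlt; apply/predU1P; left.
  by rewrite (enorm0_eq0 u0) ip0l.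
have {}u0 : 0 < enorm u by rewrite lt_neqAle eq_sym u0 enorm_ge0.
have := ip_ge0 (enorm u *: v - (ip u v / enorm u) *: u).
rewrite ipBr !ipBl !ipZr !ipZl -!enorm_sqr (ipC v u).
set p := ip u v; set a := enorm u; set b := enorm v => h.
have h2 : p ^+ 2 <= (a * b) ^+ 2.
  rewrite -subr_ge0; apply: le_trans h _; rewrite le_eqVlt; apply/predU1P; left.
  by field; rewrite gt_eqF.
have ab0 : 0 <= a * b by rewrite mulr_ge0 ?enorm_ge0.
apply: le_trans (ler_norm _) _.
by rewrite -ler_sqr ?nnegrE// real_normK ?num_real.
Qed.

Lemma ip_sumr (I : Type) (s : seq I) (P : pred I) u (v : I -> 'M[R]_(m, n)) :
  ip u (\sum_(i <- s | P i) v i) = \sum_(i <- s | P i) ip u (v i).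
Proof. by apply: (big_morph (ip u) (ipDr u)); rewrite ipC ip0l. Qed.

Lemma ip_suml (I : Type) (s : seq I) (P : pred I) u (v : I -> 'M[R]_(m, n)) :
  ip (\sum_(i <- s | P i) v i) u = \sum_(i <- s | P i) ip (v i) u.
Proof. by rewrite ipC ip_sumr; apply: eq_bigr => i _; exact: ipC. Qed.

Lemma enormD u v : enorm (u + v) <= enorm u + enorm v.
Proof.
rewrite -ler_sqr ?nnegrE ?addr_ge0 ?enorm_ge0// enorm_sqr sqrrD !enorm_sqr.
by rewrite ipDl !ipDr (ipC v u); have := ip_le_enorm u v; lra.
Qed.

Lemma enormZ a u : enorm (a *: u) = `|a| * enorm u.
Proof.
apply/eqP; rewrite -(@eqrXn2 _ 2) ?mulr_ge0 ?enorm_ge0//.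
by rewrite exprMn !enorm_sqr real_normK ?num_real// ipZl ipZr mulrA.
Qed.

Lemma enormN u : enorm (- u) = enorm u.
Proof. by rewrite -scaleN1r enormZ normrN1 mul1r. Qed.

Lemma enorm_sum (I : Type) (s : seq I) (P : pred I) (v : I -> 'M[R]_(m, n)) :
  enorm (\sum_(i <- s | P i) v i) <= \sum_(i <- s | P i) enorm (v i).
Proof.
apply: (big_ind2 (fun u d => enorm u <= d)) => // [|u d v' d' ud vd'].
  by rewrite -(scale0r 0) enormZ normr0 mul0r.
exact: le_trans (enormD _ _) (lerD ud vd').
Qed.

Lemma enorm_dist u v : `|enorm u - enorm v| <= enorm (u - v).
Proof.
rewrite ler_norml lerNl opprB; apply/andP; split.
  by rewrite lerBlDr -(enormN (u - v)) opprB -{1}(subrK u v) enormD.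
by rewrite lerBlDr -{1}(subrK v u) enormD.
Qed.

Lemma continuous_ipr u : continuous (ip u).
Proof.
rewrite /ip; apply: continuous_big => [|i _]; first exact: add_continuous.
apply: continuous_big => [|j _ w]; first exact: add_continuous.
apply: continuousM; first exact: cst_continuous.
exact: coord_continuous.
Qed.

Lemma closed_half_space u (K : R) : closed [set v | ip u v <= K].
Proof.
exact: (preimage_closed (fun v _ => @continuous_ipr u v) (@closed_le R K)).
Qed.

Lemma convex_half_space u (K : R) : convex_set [set v | ip u v <= K].
Proof.
move=> v w l; rewrite !inE/= => uv uw.
rewrite ipDr !ipZr; have -> : K = l%:num * K + (1 - l%:num) * K.
  by ring.
by rewrite lerD ?ler_wpM2l ?subr_ge0 ?le1.
Qed.

End InnerProduct.

(** * Filippov sets of regular fields *)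

(** Since the definition of the Filippov set discards null sets, a linear
    functional is bounded on it by any of its local essential upper bounds. *)
Lemma filippov_ip_le (R : realType) (m n : nat)
    (f : R -> 'M[R]_(m, n) -> 'M[R]_(m, n)) t x (S : set 'M[R]_(m, n))
    (e : 'M[R]_(m, n)) (K : R) :
  lebesgue_null S -> (\forall y \near x, ~ S y -> ip e (f t y) <= K) ->
  forall u, filippov f t x u -> ip e u <= K.
Proof.
move=> S0 /eball_nbhs[d d0 dS] u /(_ d d0 S S0) uC.
apply: (uC [set v | ip e v <= K]); split; first by split; [exact: closed_half_space|exact: convex_half_space].
by move=> _ [y [xy Sy] <-]; exact: dS.
Qed.

(** The value at a point of continuity survives the removal of null sets
    because their complement is dense. *)
Lemma filippov_continuous (R : realType) (m n : nat)
    (f : R -> 'M[R]_(m, n) -> 'M[R]_(m, n)) t x :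
  {for x, continuous (f t)} -> filippov f t x (f t x).
Proof.
move=> fx d /= d0 S S0 C [[clC _] CS]; apply: clC => B /fx/eball_nbhs[d' d'0 d'B].
have [|y [xy Sy]] := @lebesgue_null_eball _ _ _ x (Num.min d d') _ _ S0.
  by rewrite lt_min d0.
move: xy; rewrite /eball/= lt_min => /andP[xd xd'].
exists (f t y); split; last exact: d'B.
by apply: CS; exists y.
Qed.

Lemma within_slice (R : realType) (n : nat) (F : R * 'rV[R]_n -> 'rV[R]_n)
    (A : set 'rV[R]_n) (t : R) (x : 'rV[R]_n) :
  {within [set q | 0 <= q.1 /\ A q.2], continuous F} -> 0 <= t -> A x ->
  forall e : R, 0 < e -> \forall y \near x, A y -> `|F (t, x) - F (t, y)| < e.
Proof.
move=> /subspace_continuousP/(_ (t, x)) cF t0 Ax e e0.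
have /cvgrPdist_lt/(_ _ e0) := cF (conj t0 Ax).
rewrite /within/= => near_tx.
have tx : (t, y) @[y --> x] --> (t, x).
  apply: (@cvg_pair _ _ _ (nbhs x) (nbhs t) (nbhs x) _ _ _ (fun=> t) id).
    exact: cvg_cst.
  exact: cvg_id.
have near_x : \forall y \near x, 0 <= t /\ A y -> `|F (t, x) - F (t, y)| < e.
  exact: tx near_tx.
by apply: filterS near_x => y h Ay; exact: h.
Qed.

(** What the dissipation estimate needs of a nonlinearity away from its
    switching set: there it is locally bounded, and each of its values belongs to
    its own Filippov set. *)
Definition regular_on (R : realType) (n : nat) (f : R -> 'rV[R]_n -> 'rV[R]_n)
    (D : set 'rV[R]_n) : Prop :=
  forall t : R, 0 <= t ->
    (forall x, D x -> filippov f t x (f t x)) /\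
    forall x : 'rV[R]_n, exists K, \forall y \near x, D y -> enorm (f t y) <= K.

Lemma enorm_le_norm (R : realType) (m n : nat) (v : 'M[R]_(m, n)) :
  enorm v <= (m * n)%:R * `|v|.
Proof. by apply: enorm_le_coord => // i j; exact: coord_le_norm. Qed.

Lemma enorm_bounded_near (R : realType) (m n : nat) (x a : 'M[R]_(m, n))
    (G : 'M[R]_(m, n) -> 'M[R]_(m, n)) (P : set 'M[R]_(m, n)) :
  (\forall y \near x, P y -> `|a - G y| < 1) ->
  \forall y \near x, P y -> enorm (G y) <= (m * n)%:R * (`|a| + 1).
Proof.
apply: filterS => y h Py; apply: le_trans (enorm_le_norm _) _.
rewrite ler_wpM2l//; apply: (@le_trans _ _ (`|a| + `|G y - a|)).
  by rewrite -{1}(subrK a (G y)) addrC ler_normD.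
by rewrite lerD2l distrC ltW// h.
Qed.

Lemma continuous_or_pws_regular (R : realType) (n : nat)
    (f : R -> 'rV[R]_n -> 'rV[R]_n) : (0 < n)%N -> continuous_or_pws f ->
  exists2 D, lebesgue_null (~` D) & regular_on f D.
Proof.
move=> n0 [cf|[p [S [F [[openS _] coverS _ fF nullS]]]]].
  exists setT; first by rewrite setCT; exact: lebesgue_null0.
  move=> t t0.
  have slice x e : 0 < e -> \forall y \near x, `|f t x - f t y| < e.
    move=> e0; have := @within_slice _ _ (fun q => f q.1 q.2) setT t x.
    rewrite (_ : [set q | _] = [set q | 0 <= q.1]); last first.
      by apply/seteqP; split=> [q []//|q]; split.
    move=> /(_ cf t0 I e e0); apply: filterS => y; exact.
  split=> [x _|x].
    apply: filippov_continuous.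
    by apply/(cvgrPdist_lt (FF := nbhs_filter x)) => e; exact: slice.
  exists ((1 * n)%:R * (`|f t x| + 1)).
  have near_x : \forall y \near x, setT y -> `|f t x - f t y| < 1.
    by have := slice x 1 ltr01; apply: filterS => y h _.
  exact: (enorm_bounded_near near_x).
exists (\bigcup_k S k) => // t t0.
have slice k x e : closure (S k) x -> 0 < e ->
    \forall y \near x, closure (S k) y -> `|F k (t, x) - F k (t, y)| < e.
  by move=> Skx e0; apply: within_slice => //; have [] := fF k.
split=> [x [k _ Skx]|x].
  apply: filippov_continuous; apply/(cvgrPdist_lt (FF := nbhs_filter x)) => e e0.
  have := slice k x e (subset_closure Skx) e0.
  have := open_nbhs_nbhs (conj (openS k).1 Skx).
  have [fE _ _] := fF k.
  apply: filterS2 => y Sky h; rewrite !fE//.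
  by apply: h; exact: subset_closure.
have near_k k : exists K, \forall y \near x, S k y -> enorm (f t y) <= K.
  have [fE _ _] := fF k.
  have [Skx|Skx] := pselect (closure (S k) x).
    exists ((1 * n)%:R * (`|F k (t, x)| + 1)).
    have := enorm_bounded_near (G := fun y => F k (t, y)) (slice k x 1 Skx ltr01).
    apply: filterS => y h Sky; rewrite fE//; apply: h; exact: subset_closure.
  exists 0; have : nbhs x (~` closure (S k)).
    by apply: open_nbhs_nbhs; split => //; exact/closed_openC/closed_closure.
  by apply: filterS => y h /subset_closure.
have [K hK] := choice near_k.
exists (\big[Num.max/0]_k K k).
have : \forall y \near x, forall k, S k y -> enorm (f t y) <= K k.
  exact: (filter_forall (f := fun k y => S k y -> enorm (f t y) <= K k)
    (nbhs_filter x) hK).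
apply: filterS => y h [k _ Sky]; apply: le_trans (h k Sky) _.
exact: le_bigmax.
Qed.

(** * Absolutely continuous functions with nonpositive derivative *)

Definition ac_on (R : realType) (a b : R) (phi : R -> R) : Prop :=
  forall eps : R, 0 < eps -> exists2 delta : R, 0 < delta &
    forall (k : nat) (u v : 'I_k -> R),
      (forall i, [/\ a <= u i, u i <= v i & v i <= b]) ->
      trivIset setT (fun i => `]u i, v i[%classic) ->
      \sum_i (v i - u i) < delta ->
      \sum_i `|phi (v i) - phi (u i)| < eps.

(** Splitting the increment at t allows intervals that contain t in their
    interior, which is what a chain passing over t needs. *)
Lemma straddle_le (R : realType) (phi : R -> R) (t eps : R) :
  0 < eps -> derivable phi t 1 -> 'D_1 phi t <= 0 ->
  exists2 rho : R, 0 < rho & forall s w, t - rho < s -> s <= t -> t <= w ->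
    w < t + rho -> phi w - phi s <= eps * (w - s).
Proof.
move=> eps0 dphi Dphi.
have /cvgrPdist_lt/(_ _ eps0) : h^-1 *: (phi (h *: (1 : R) + t) - phi t)
    @[h --> 0^'] --> 'D_1 phi t by exact: dphi.
move=> /nbhs_ballP[rho /= rho0 near_t]; exists rho => //.
have slope h : `|h| < rho -> h != 0 -> (phi (h + t) - phi t) / h < eps.
  move=> hrho h0; have hb : ball 0 rho h by rewrite -ball_normE/= sub0r normrN.
  have /= := near_t h hb h0.
  rewrite [h *: _]mulr1 [_ *: _]mulrC distrC => /(le_lt_trans (ler_norm _)).
  by rewrite ltrBlDr => /lt_le_trans; apply; rewrite gerDl.
move=> s w ts st tw wt.
have hw : phi w - phi t <= eps * (w - t).
  have [->|wnt] := eqVneq w t; first by rewrite !subrr mulr0.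
  have h0 : 0 < w - t by rewrite subr_gt0 lt_neqAle eq_sym wnt.
  have := slope (w - t); rewrite gtr0_norm// subrK gt_eqF//.
  by rewrite ltrBlDl wt => /(_ isT isT); rewrite ltr_pdivrMr// => /ltW.
have hs : phi t - phi s <= eps * (t - s).
  have [->|snt] := eqVneq s t; first by rewrite !subrr mulr0.
  have h0 : s - t < 0 by rewrite subr_lt0 lt_neqAle snt.
  have := slope (s - t); rewrite ltr0_norm// subrK lt_eqF//.
  rewrite opprB ltrBlDl -ltrBlDr ts => /(_ isT isT).
  by rewrite ltr_ndivrMr// -(opprB s t) mulrN lerNr opprB => /ltW.
lra.
Qed.

Lemma ae_open_cover (R : realType) (P : R -> Prop) (a b delta : R) :
  {ae lebesgue_measure, forall t, P t} -> 0 < delta ->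
  exists U : set R, [/\ open U, (lebesgue_measure U < delta%:E)%E, U a, U b &
    forall t, U t \/ P t].
Proof.
move=> [A [mA A0 PA]] delta0.
pose mu := @lebesgue_measure R; pose A' := A `|` [set a; b].
have mab : measurable ([set a; b] : set R) by exact: measurableU.
have mA' : measurable A' by exact: measurableU.
have A'0 : mu A' = 0%E.
  apply/eqP; rewrite eq_le measure_ge0 andbT.
  apply: le_trans (measureU2 mu mA mab) _; rewrite [X in (X + _)%E]A0 add0e.
  apply: le_trans (measureU2 mu _ _) _ => //.
  by rewrite [X in (X + _)%E]lebesgue_measure_set1 [X in (_ + X)%E]lebesgue_measure_set1 adde0.
have [|U [openU A'U muU]] := lebesgue_regularity_outer mA' _ delta0.
  by rewrite [X in (X < _)%E]A'0.
have mU : measurable U by exact: open_measurable.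
exists U; split=> //.
- have UE : U = (U `\` A') `|` A' by rewrite setUC setDUK.
  rewrite UE; apply: le_lt_trans (measureU2 mu _ _) _ => //.
    exact: measurableD.
  by rewrite [X in (_ + X)%E]A'0 adde0.
- by apply: A'U; right; left.
- by apply: A'U; right; right.
- move=> t; have [Pt|nPt] := pselect (P t); first by right.
  by left; apply: A'U; left; apply: PA.
Qed.

(** A certificate that is extended from left to right.  Outside of the listed
    intervals phi grows at rate at most eps; the intervals cover the points where
    the derivative is not controlled, and are paid for with the measure of U. *)
Definition growth_chain (R : realType) (phi : R -> R) (U : set R) (a eps s : R) :=
  exists (k : nat) (u v : nat -> R),
    [/\ forall i, (i < k)%N -> [/\ a <= u i, u i <= v i & v i <= s],
        forall i j, (i < j < k)%N -> v i <= u j,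
        ((\sum_(i < k) (v i - u i))%:E <= lebesgue_measure (U `&` `[a, s]))%E &
        phi s - phi a <= eps * (s - a) + \sum_(i < k) `|phi (v i) - phi (u i)|].

Lemma growth_chain_flat (R : realType) (phi : R -> R) (U : set R) (a eps s w : R) :
  open U -> a <= s -> s <= w -> phi w - phi s <= eps * (w - s) ->
  growth_chain phi U a eps s -> growth_chain phi U a eps w.
Proof.
move=> oU as_ sw slope [k [u [v [uvs vu len inc]]]]; exists k, u, v; split=> //.
- by move=> i /uvs[h1 h2 h3]; split=> //; exact: le_trans sw.
- apply: le_trans len _; apply: le_measure; rewrite ?inE.
  + by apply: measurableI => //; exact: open_measurable.
  + by apply: measurableI => //; exact: open_measurable.
  + apply: setIS => x /=; rewrite !in_itv/= => /andP[-> xs].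
    exact: le_trans xs sw.
- lra.
Qed.

Lemma growth_chain_jump (R : realType) (phi : R -> R) (U : set R) (a eps s w : R) :
  open U -> 0 < eps -> a <= s -> s <= w -> `[s, w]%classic `<=` U ->
  growth_chain phi U a eps s -> growth_chain phi U a eps w.
Proof.
move=> oU eps0 as_ sw swU [k [u [v [uvs vu len inc]]]].
have mU : measurable U by exact: open_measurable.
exists k.+1, (fun i => if (i < k)%N then u i else s),
  (fun i => if (i < k)%N then v i else w); split.
- move=> i _; case: ifP => [/uvs[h1 h2 h3]|_]; split=> //.
  exact: le_trans sw.
- move=> i j; rewrite ltnS => /andP[ij jk].
  rewrite (leq_trans ij jk); case: ifPn => jk'; first by apply: vu; rewrite ij.
  by have [] := uvs i (leq_trans ij jk).
- rewrite big_ord_recr/= ltnn.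
  under eq_bigr => i _ do rewrite ltn_ord.
  apply: (@le_trans _ _
      (lebesgue_measure ((U `&` `[a, s]%classic) `|` `]s, w]%classic))).
    rewrite measureU//=; last 2 first.
    + exact: measurableI.
    + apply/seteqP; split=> // x [[_ +] +]; rewrite /= !in_itv/= => /andP[_ xs].
      by move=> /andP[/lt_le_trans/(_ xs)]; rewrite ltxx.
    rewrite EFinD; apply: leeD => //.
    rewrite lebesgue_measure_itv/= lte_fin; case: ifP => //.
    by move=> /negbT; rewrite -leNgt lee_fin subr_le0.
  apply: le_measure; rewrite ?inE.
  + by apply: measurableU => //; exact: measurableI.
  + exact: measurableI.
  + move=> x [[Ux +]|]; rewrite /= !in_itv/= => /andP[h1 h2].
      by rewrite h1 (le_trans h2 sw).
    rewrite h2 (le_trans as_ (ltW h1)); split=> //.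
    by apply: swU; rewrite /= in_itv/= h2 ltW.
- rewrite big_ord_recr/= ltnn.
  under eq_bigr => i _ do rewrite ltn_ord.
  have := ler_norm (phi w - phi s).
  have : eps * (s - a) <= eps * (w - a) by rewrite ler_pM2l// lerD2r.
  lra.
Qed.

(** The intervals of a growth chain that reaches b lie in a set of small
    measure, so absolute continuity bounds the variation of phi over them. *)
Lemma ac_nonincreasing (R : realType) (phi : R -> R) (a b : R) :
  a <= b -> ac_on a b phi ->
  {ae lebesgue_measure, forall t, a < t < b ->
     derivable phi t 1 /\ 'D_1 phi t <= 0} ->
  phi b <= phi a.
Proof.
move=> ab acphi aephi; rewrite -subr_le0; apply/ler_addgt0Pr => e0 e0_gt0.
rewrite add0r; pose eps := e0 / (b - a + 1).
have ba1 : 0 < b - a + 1 by rewrite ltr_wpDl// subr_ge0.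
have eps0 : 0 < eps by rewrite divr_gt0.
have [delta delta0 acdelta] := acphi _ eps0.
have [U [oU muU Ua Ub UP]] := ae_open_cover a b aephi delta0.
suff [k [u [v [uvs vu len inc]]]] : growth_chain phi U a eps b.
  apply: le_trans inc _.
  have : \sum_(i < k) `|phi (v i) - phi (u i)| < eps.
    apply: (acdelta k (fun i => u i) (fun i => v i)) => [i||].
    - exact: uvs.
    - apply/trivIsetP => i j _ _; wlog ij : i j / (i < j)%N.
        move=> H inj; have [ij|ji|/val_inj eij] := ltngtP i j.
        + exact: H.
        + by rewrite setIC; apply: H => //; rewrite eq_sym.
        + by rewrite eij eqxx in inj.
      move=> _; apply/seteqP; split=> // x [/=]; rewrite !in_itv/=.
      move=> /andP[_ xv] /andP[ux _].
      have := lt_trans ux xv; rewrite ltNge vu//.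
      by rewrite ij ltn_ord.
    - rewrite -lte_fin; apply: le_lt_trans len _; apply: le_lt_trans muU.
      apply: le_measure; rewrite ?inE; [|exact: open_measurable|exact: subIsetl].
      by apply: measurableI => //; exact: open_measurable.
  move=> /ltW; rewrite -(lerD2l (eps * (b - a))) => /le_trans; apply.
  have -> : eps * (b - a) + eps = eps * (b - a + 1) by ring.
  by rewrite /eps divfK// gt_eqF.
pose A := [set s | a <= s <= b /\ growth_chain phi U a eps s].
have Aa : A a.
  split; first by rewrite lexx ab.
  exists 0%N, (fun=> a), (fun=> a); split=> //.
    by rewrite big_ord0 measure_ge0.
  by rewrite big_ord0 !subrr mulr0 addr0.
have supA : has_sup A.
  split; first by exists a.
  by exists b => s [/andP[_ sb] _].
have aS : a <= sup A by exact: sup_upper_bound.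
have Sb : sup A <= b by apply: ge_sup => [|s [/andP[_ sb] _]//]; exists a.
have [rho rho0 step] : exists2 rho : R, 0 < rho & forall s w, a <= s ->
    sup A - rho < s -> s <= sup A -> sup A <= w -> w < sup A + rho ->
    growth_chain phi U a eps s -> growth_chain phi U a eps w.
  have [US|nUS] := pselect (U (sup A)).
    have /nbhs_ballP[rho /= rho0 rhoU] := open_nbhs_nbhs (conj oU US).
    exists rho => // s w as_ ss sS Sw wS; apply: growth_chain_jump => //.
      exact: le_trans Sw.
    move=> x /=; rewrite in_itv/= => /andP[sx xw]; apply: rhoU.
    rewrite -ball_normE/= ltr_distlC (lt_le_trans ss sx)/=.
    exact: le_lt_trans xw wS.
  have [//|dS] := UP (sup A); have [|dphi Dphi] := dS.
    rewrite !lt_neqAle aS Sb !andbT; apply/andP; split; apply/eqP => E.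
      by apply: nUS; rewrite -E.
    by apply: nUS; rewrite E.
  have [rho rho0 slope] := straddle_le eps0 dphi Dphi.
  exists rho => // s w as_ ss sS Sw wS.
  apply: growth_chain_flat => //; first exact: le_trans Sw.
  exact: slope.
have [s [/andP[as_ sb] chs] ss] := sup_adherent rho0 supA.
pose w := Num.min b (sup A + rho / 2).
have Sw : sup A <= w by rewrite le_min Sb lerDl divr_ge0// ltW.
have chw : growth_chain phi U a eps w.
  have wS : w < sup A + rho.
    by rewrite gt_min ltrD2l ltr_pdivrMr// ltr_pMr// ltr1n orbT.
  by apply: (step s) => //; apply: sup_upper_bound => //; split => //; rewrite as_.
have : w <= sup A.
  apply: sup_upper_bound => //; split=> //.
  by rewrite (le_trans aS Sw) ge_min lexx.
rewrite ge_min [X in _ || X]leNgt ltrDl divr_gt0//= orbF => bS.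
suff <- : w = b by [].
by apply: min_idPl; rewrite (le_trans bS)// lerDl divr_ge0// ltW.
Qed.

(** * Spectral gap of the Laplacian *)

Lemma sum_symmetrize (R : realFieldType) (N : nat) (F : 'I_N -> 'I_N -> R) :
  \sum_i \sum_j F i j = 2^-1 * \sum_i \sum_j (F i j + F j i).
Proof.
under [in RHS]eq_bigr => i _ do rewrite big_split.
by rewrite big_split/= [X in _ + X]exchange_big/=; field.
Qed.

Section Laplacian.
Variables (R : realType) (N : nat) (A : 'M[R]_N).
Hypothesis hA : weighted_graph A.
Implicit Types x y v : 'rV[R]_N.

(** The sum may range over k = j as well: the weight A j j of a loop cancels. *)
Lemma laplacian_coord x j :
  (x *m laplacian A) ord0 j = \sum_k A j k * (x ord0 j - x ord0 k).
Proof.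
rewrite mxE (bigD1 j)//= mxE eqxx mulr_sumr [RHS](bigD1 j)//= subrr mulr0 add0r.
rewrite -big_split/=; apply: eq_bigr => k /negbTE kj.
by rewrite mxE kj (hA k j).1; ring.
Qed.

Lemma ip_laplacian x y : ip (x *m laplacian A) y =
  2^-1 * \sum_i \sum_j A i j * ((x ord0 i - x ord0 j) * (y ord0 i - y ord0 j)).
Proof.
rewrite /ip big_ord1.
under eq_bigr => i _ do rewrite laplacian_coord mulrC mulr_sumr.
rewrite sum_symmetrize; congr (_ * _).
by apply: eq_bigr => i _; apply: eq_bigr => j _; rewrite (hA j i).1; ring.
Qed.

Lemma sum_laplacian x : \sum_j (x *m laplacian A) ord0 j = 0.
Proof.
have := ip_laplacian x (const_mx 1); rewrite /ip big_ord1.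
rewrite (eq_bigr (fun j => (x *m laplacian A) ord0 j)); last first.
  by move=> j _; rewrite [const_mx 1 _ _]mxE mulr1.
by move=> ->; rewrite big1 ?mulr0// => i _; rewrite big1// => j _; rewrite !mxE subrr !mulr0.
Qed.

Definition dirichlet x : R :=
  2^-1 * \sum_i \sum_j A i j * (x ord0 i - x ord0 j) ^+ 2.

Lemma dirichletE x : dirichlet x = ip (x *m laplacian A) x.
Proof.
by rewrite ip_laplacian; congr (_ * _); apply: eq_bigr => i _; apply: eq_bigr.
Qed.

Lemma dirichlet_ge0 x : 0 <= dirichlet x.
Proof.
rewrite mulr_ge0 ?invr_ge0//; apply: sumr_ge0 => i _; apply: sumr_ge0 => j _.
by rewrite mulr_ge0 ?sqr_ge0 ?(hA i j).2.
Qed.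

(** A vanishing Dirichlet form makes the vector constant across every edge. *)
Lemma dirichlet_eq0 x : connected_graph A -> dirichlet x = 0 ->
  forall i j, x ord0 i = x ord0 j.
Proof.
move=> conn /eqP; rewrite mulf_eq0 invr_eq0 pnatr_eq0/= => /eqP x0.
have terms0 i j : A i j * (x ord0 i - x ord0 j) ^+ 2 = 0.
  have ge0 k l : 0 <= A k l * (x ord0 k - x ord0 l) ^+ 2.
    by rewrite mulr_ge0 ?sqr_ge0 ?(hA k l).2.
  have row_ge0 k : true -> 0 <= \sum_l A k l * (x ord0 k - x ord0 l) ^+ 2.
    by move=> _; apply: sumr_ge0.
  have /(psumr_eq0P row_ge0)/(_ i isT) := x0.
  by move=> /(psumr_eq0P (fun l _ => ge0 i l))/(_ j isT).
have edge_eq i j : edge A i j -> x ord0 i = x ord0 j.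
  move=> /andP[_ Aij]; have /eqP := terms0 i j.
  by rewrite mulf_eq0 gt_eqF//= sqrf_eq0 subr_eq0 => /eqP.
move=> i j; have /connectP[p + ->] := conn i j.
elim: p i => //= k p IHp i /andP[/edge_eq -> ]; exact: IHp.
Qed.

Lemma continuous_dirichlet : continuous dirichlet.
Proof.
pose q x := \sum_i \sum_j A i j * (x ord0 i - x ord0 j) ^+ 2.
have cq : continuous q.
  apply: continuous_big => [|i _]; first exact: add_continuous.
  apply: continuous_big => [|j _ x]; first exact: add_continuous.
  have cij : {for x, continuous (fun x : 'rV[R]_N => x ord0 i - x ord0 j)}.
    by apply: continuousB; exact: coord_continuous.
  apply: (@continuousM _ _ (fun=> A i j) (fun x : 'rV[R]_N => (x ord0 i - x ord0 j) ^+ 2)); first exact: cst_continuous.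
  exact: (continuousM cij cij).
by move=> x; apply: (@continuousM _ _ (fun=> 2^-1) q); [exact: cst_continuous|exact: cq].
Qed.

End Laplacian.

Lemma quadratic_ge0 (R : realFieldType) (p q : R) : 0 <= p ->
  (forall s, 0 <= 2 * s * p + s ^+ 2 * q) -> p = 0.
Proof.
move=> p0 h; apply/eqP; rewrite eq_le p0 andbT leNgt; apply/negP => {}p0.
(* at this s the negative linear term dominates the quadratic one *)
have q1 : 0 < `|q| + 1 by rewrite ltr_wpDl.
pose s := - p / (`|q| + 1).
have sq : s * (`|q| + 1) = - p by rewrite /s divfK// gt_eqF.
have s0 : s < 0 by rewrite /s mulNr oppr_lt0 divr_gt0.
have qle := ler_norm q.
have : s ^+ 2 * q <= s * (- p) - s ^+ 2.
  rewrite -sq mulrA -expr2 mulrDr mulr1 addrK.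
  by rewrite ler_wpM2l ?sqr_ge0.
have := h s; have : 0 <= s ^+ 2 by rewrite sqr_ge0.
have : s * p < 0 by rewrite nmulr_rlt0.
lra.
Qed.

(** The minimum of the Dirichlet form on the unit sphere of the mean-zero
    vectors is attained, at an eigenvector, and it is positive because the
    Dirichlet form of a connected graph vanishes only on constants. *)
Lemma laplacian_gap (R : realType) (N : nat) (A : 'M[R]_N) :
  weighted_graph A -> connected_graph A -> (1 < N)%N ->
  exists mu : R, [/\ 0 < mu,
    exists2 v : 'rV[R]_N, v *m laplacian A = mu *: v & v != 0 &
    forall x : 'rV[R]_N, \sum_i x ord0 i = 0 -> mu * ip x x <= dirichlet A x].
Proof.
move=> hA conn N1.
pose K : set 'rV[R]_N := [set x : 'rV[R]_N | \sum_i x ord0 i = 0 /\ ip x x = 1].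
have normalize (x : 'rV[R]_N) : x != 0 -> \sum_i x ord0 i = 0 ->
    enorm x != 0 /\ K ((enorm x)^-1 *: x).
  move=> x0 sx.
  have nx : enorm x != 0.
    by apply: contra_neq x0; exact: enorm0_eq0.
  split=> //; split; last first.
    by rewrite ipZl ipZr -enorm_sqr; field.
  under eq_bigr => j _ do rewrite mxE.
  by rewrite -mulr_sumr sx mulr0.
have K0 : K !=set0.
  pose i0 : 'I_N := Ordinal (ltnW N1); pose i1 : 'I_N := Ordinal N1.
  pose x : 'rV[R]_N := delta_mx 0 i0 - delta_mx 0 i1.
  have x0 : x != 0.
    by apply/eqP => /rowP/(_ i0)/eqP; rewrite !mxE !eqxx/= subr0 oner_eq0.
  exists ((enorm x)^-1 *: x); apply: (normalize x x0 _).2.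
  have sdelta (i : 'I_N) : \sum_j (delta_mx 0 i : 'rV[R]_N) ord0 j = 1.
    rewrite (bigD1 i)//= mxE !eqxx big1 ?addr0// => j /negbTE ji.
    by rewrite mxE ji.
  rewrite (eq_bigr (fun j => (delta_mx 0 i0 : 'rV[R]_N) ord0 j -
    (delta_mx 0 i1 : 'rV[R]_N) ord0 j)) => [|j _]; last by rewrite !mxE.
  by rewrite sumrB !sdelta subrr.
have compK : compact K.
  apply: bounded_closed_compact.
    exists 1; split=> // M M1 x [_ x1].
    apply: le_trans (norm_le_enorm x) _.
    apply: le_trans _ (ltW M1).
    by rewrite -ler_sqr ?nnegrE ?enorm_ge0// enorm_sqr x1 expr1n.
  apply: closedI.
    apply: (preimage_closed (f := fun x : 'rV[R]_N => \sum_i x ord0 i)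
      _ (@closed_eq R 0)) => x _.
    apply: continuous_big => [|i _]; first exact: add_continuous.
    exact: coord_continuous.
  apply: (preimage_closed (f := fun x : 'rV[R]_N => ip x x)
    _ (@closed_eq R 1)) => x _; rewrite /ip; move: x.
  apply: continuous_big => [|i _]; first exact: add_continuous.
  apply: continuous_big => [|j _ x]; first exact: add_continuous.
  by apply: continuousM; exact: coord_continuous.
have cdir : {within K, continuous (dirichlet A)}.
  exact/continuous_subspaceT/continuous_dirichlet.
have [v] := EVT_min_rV K0 compK cdir.
rewrite inE => -[sv v1] vmin; pose mu := dirichlet A v.
have v0 : v != 0.
  by apply: contra_eq_neq v1 => ->; rewrite ip0l eq_sym oner_eq0.
have rayleigh (x : 'rV[R]_N) : \sum_i x ord0 i = 0 -> mu * ip x x <= dirichlet A x.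
  move=> sx; have [->|x0] := eqVneq x 0.
    by rewrite ip0l mulr0 dirichlet_ge0.
  have [nx Kx] := normalize x x0 sx.
  have := vmin _ (mem_set Kx); rewrite !dirichletE// -scalemxAl ipZl ipZr.
  rewrite -enorm_sqr => h; rewrite /mu dirichletE//.
  have nx2 : 0 < enorm x ^+ 2 by rewrite exprn_gt0// lt_neqAle eq_sym nx enorm_ge0.
  rewrite -ler_pdivlMr//; apply: le_trans h _; rewrite le_eqVlt; apply/predU1P.
  by left; field.
exists mu; split=> //.
- rewrite lt_neqAle dirichlet_ge0// andbT eq_sym.
  apply: contra_neq v0 => /(dirichlet_eq0 hA conn) vc.
  apply/rowP => j; rewrite mxE.
  move: sv; rewrite (eq_bigr (fun=> v ord0 j)); last by move=> i _; exact: vc.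
  rewrite sumr_const card_ord => /eqP; rewrite mulrn_eq0 => /orP[|/eqP//].
  by rewrite -leqn0 leqNgt (ltnW N1).
- exists v => //; apply/eqP; rewrite -subr_eq0.
  have [z zE] : exists z, z = v *m laplacian A - mu *: v by eexists.
  rewrite -zE.
  have sz : \sum_i z ord0 i = 0.
    rewrite (eq_bigr (fun j => (v *m laplacian A) ord0 j - mu * v ord0 j));
      last by move=> j _; rewrite zE !mxE.
    by rewrite sumrB sum_laplacian// -mulr_sumr sv mulr0 subrr.
  have zz : ip z z = 0.
    apply: (@quadratic_ge0 _ _ (dirichlet A z - mu * ip z z)).
      exact: ip_ge0.
    move=> s; have := rayleigh (v + s *: z); rewrite -subr_ge0.
    have -> : \sum_i (v + s *: z) ord0 i = 0.
      rewrite (eq_bigr (fun j => v ord0 j + s * z ord0 j));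
        last by move=> j _; rewrite [LHS]mxE; congr (_ + _); rewrite mxE.
      by rewrite big_split/= -mulr_sumr sv sz mulr0 addr0.
    move=> /(_ erefl) /le_trans; apply; rewrite le_eqVlt; apply/predU1P; left.
    have symL (x y : 'rV[R]_N) : ip (x *m laplacian A) y = ip (y *m laplacian A) x.
      rewrite !ip_laplacian//; congr (_ * _); apply: eq_bigr => i _.
      by apply: eq_bigr => j _; ring.
    rewrite !dirichletE// mulmxDl -scalemxAl !ipDl !ipDr !ipZl !ipZr.
    rewrite (symL z v) (ipC z v) v1 -(dirichletE hA v) -/mu.
    have -> : ip z z = ip (v *m laplacian A) z - mu * ip v z.
      by rewrite {1}zE ipBl ipZl.
    ring.
  exact/eqP/ip0_eq0.
Qed.

Lemma mulmx_diag_coord (R : pzRingType) (n : nat) (D : 'M[R]_n) (x : 'rV[R]_n) j :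
  is_diag_mx D -> (x *m D) ord0 j = x ord0 j * D j j.
Proof.
move=> /is_diag_mxP Ddiag; rewrite mxE (bigD1 j)//= big1 ?addr0// => i ij.
by rewrite Ddiag ?mulr0.
Qed.

Lemma eigenvalue_diagP (R : fieldType) (n : nat) (D : 'M[R]_n) (a : R) :
  is_diag_mx D -> eigenvalue D a <-> exists i, a = D i i.
Proof.
move=> Ddiag; split=> [/eigenvalueP[v /rowP vD /rV0Pn[j vj]]|[j ->]].
  exists j; have := vD j; rewrite mulmx_diag_coord// mxE mulrC.
  by move=> /(mulIf vj).
apply/eigenvalueP; exists (delta_mx 0 j).
  apply/rowP => k; rewrite mulmx_diag_coord// !mxE eqxx/=.
  by case: eqP => [->|_]; rewrite ?mul1r ?mulr1 ?mul0r ?mulr0.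
by apply/rV0Pn; exists j; rewrite mxE !eqxx oner_eq0.
Qed.

Lemma lambda_max_diag (R : realType) (n : nat) (D : 'M[R]_n) :
  (0 < n)%N -> is_diag_mx D ->
  exists i, lambda_max D = (D i i)%:E /\ forall j, D j j <= D i i.
Proof.
move=> n0 Ddiag; pose i0 := Ordinal n0.
case: (@arg_maxP _ _ _ i0 xpredT (fun i => D i i) isT) => i _ imax.
exists i; split; last by move=> j; exact: imax.
apply/eqP; rewrite eq_le; apply/andP; split.
  apply: ge_ereal_sup => _ [a /= /(eigenvalue_diagP _ Ddiag)[j ->] <-].
  by rewrite lee_fin; exact: imax.
apply: ereal_sup_ubound; exists (D i i) => //=.
by apply/eigenvalue_diagP => //; exists i.
Qed.

Lemma lambda_max_nil (R : realType) (n : nat) (D : 'M[R]_n) :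
  n = 0%N -> lambda_max D = -oo%E.
Proof.
move=> n0; rewrite /lambda_max (_ : [set _ | _] = set0) ?image_set0 ?ereal_sup0//.
apply/seteqP; split=> // a /= /eigenvalueP[v _ /rV0Pn[j _]].
by have := leq_ltn_trans (leq0n j) (ltn_ord j); rewrite n0.
Qed.

(** A row vector of size N * r is a family of r vectors of size N, on which
    L *t D acts separately when D is diagonal. *)
Lemma tensmx_diag_coord (R : comPzRingType) (N r : nat) (L : 'M[R]_N)
    (D : 'M[R]_r) (v : 'rV[R]_(N * r)) i l : is_diag_mx D ->
  (v *m (L *t D)) ord0 (mxtens_index (i, l)) =
  D l l * ((\row_k v ord0 (mxtens_index (k, l))) *m L) ord0 i.
Proof.
move=> /is_diag_mxP Ddiag; rewrite !mxE mulr_sumr.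
rewrite (reindex (@mxtens_index N r))/=; last first.
  by exists (@mxtens_unindex N r) => p _; rewrite ?mxtens_indexK ?mxtens_unindexK.
rewrite (eq_bigr (fun p => v ord0 (mxtens_index (p.1, p.2)) * (L p.1 i * D p.2 l)));
  last by move=> [k m] _; rewrite tensmxE.
rewrite -(pair_bigA _ (fun k m => v ord0 (mxtens_index (k, m)) * (L k i * D m l)))/=.
apply: eq_bigr => k _; rewrite (bigD1 l)//= big1 ?addr0; last first.
  by move=> m ml; rewrite Ddiag// !mulr0.
by rewrite mxE; ring.
Qed.

(** The nonzero eigenvalues of the tensor product are the products of a nonzero
    eigenvalue of the Laplacian and a diagonal entry of D. *)
Lemma lambda_2_tens (R : realType) (N r : nat) (A : 'M[R]_N) (D : 'M[R]_r) :
  weighted_graph A -> connected_graph A -> (1 < N)%N -> (0 < r)%N ->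
  is_diag_mx D -> (forall l, 0 < D l l) ->
  exists ell : R, [/\ lambda_2 (laplacian A *t D) = ell%:E, 0 < ell &
    forall l (x : 'rV[R]_N), \sum_i x ord0 i = 0 ->
      ell * ip x x <= D l l * dirichlet A x].
Proof.
move=> hA conn N1 r0 Ddiag D0; set T := laplacian A *t D.
have [mu [mu0 [v vL v0] rayleigh]] := laplacian_gap hA conn N1.
pose l0 := Ordinal r0.
case: (@arg_minP _ _ _ l0 xpredT (fun i => D i i) isT) => m _ mmin.
have upper l : (lambda_2 T <= (D l l * mu)%:E)%E.
  apply: ereal_inf_lbound; exists (D l l * mu) => //=; split; last first.
    by rewrite mulf_neq0 ?gt_eqF.
  pose w : 'rV[R]_(N * r) := \row_p (v ord0 (@mxtens_unindex N r p).1 *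
    ((@mxtens_unindex N r p).2 == l)%:R).
  have wE k j : w ord0 (mxtens_index (k, j)) = v ord0 k * (j == l)%:R.
    by rewrite mxE mxtens_indexK.
  apply/eigenvalueP; exists w.
    apply/rowP => p; case: (mxtens_indexP p) => i j {p}.
    rewrite tensmx_diag_coord// [RHS]mxE wE.
    have [->|jl] := eqVneq j l; last first.
      rewrite (_ : \row_k _ = 0) ?mul0mx ?mxE ?mulr0//.
      by apply/rowP => k; rewrite mxE wE (negbTE jl) mulr0 mxE.
    rewrite (_ : \row_k _ = v); last first.
      by apply/rowP => k; rewrite mxE wE eqxx mulr1.
    by rewrite vL mxE mulr1 mulrA.
  have /rV0Pn[k vk] := v0.
  by apply/rV0Pn; exists (mxtens_index (k, l)); rewrite wE eqxx mulr1.
have lower : ((D m m * mu)%:E <= lambda_2 T)%E.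
  apply: le_ereal_inf_tmp => _ [a [/= /eigenvalueP[w wT w0] a0] <-].
  rewrite lee_fin; have /rV0Pn[p] := w0; case: (mxtens_indexP p) => i l {p} wil.
  pose x : 'rV[R]_N := \row_k w ord0 (mxtens_index (k, l)).
  have xL : x *m laplacian A = (a / D l l) *: x.
    apply/rowP => k; have /rowP/(_ (mxtens_index (k, l))) := wT.
    rewrite tensmx_diag_coord// -/x [(a *: w) _ _]mxE => xk.
    rewrite [RHS]mxE [x _ _]mxE mulrAC -xk mulrAC divff ?mul1r//.
    by rewrite gt_eqF.
  have aD : a / D l l != 0 by rewrite mulf_neq0 ?invr_eq0 ?(gt_eqF (D0 l)).
  have sx : \sum_k x ord0 k = 0.
    have := sum_laplacian hA x; rewrite xL.
    rewrite (eq_bigr (fun k => a / D l l * x ord0 k)); last by move=> k _; rewrite mxE.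
    by rewrite -mulr_sumr => /eqP; rewrite mulf_eq0 (negbTE aD) => /eqP.
  have xx : 0 < ip x x.
    rewrite lt_neqAle ip_ge0 andbT eq_sym; apply: contraNneq wil => /ip0_eq0.
    by move=> /rowP/(_ i); rewrite !mxE => ->.
  have := rayleigh x sx; rewrite dirichletE// xL ipZl ler_pM2r//.
  rewrite ler_pdivlMr// => /(le_trans _); apply.
  by rewrite mulrC ler_pM2l//; exact: mmin.
exists (D m m * mu); split.
- by apply/eqP; rewrite eq_le lower upper.
- by rewrite mulr_gt0.
- move=> l x sx; rewrite -mulrA; apply: ler_pM => //.
  + exact: ltW.
  + by rewrite mulr_ge0 ?ip_ge0// ltW.
  + exact: mmin.
  + exact: rayleigh.
Qed.

(** The Laplacian of a single node is zero. *)
Lemma lambda_2_single (R : realType) (N r : nat) (A : 'M[R]_N) (D : 'M[R]_r) :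
  (N <= 1)%N -> lambda_2 (laplacian A *t D) = +oo%E.
Proof.
move=> N1; have eqI (i j : 'I_N) : i = j.
  apply: val_inj; have := leq_trans (ltn_ord i) N1; have := leq_trans (ltn_ord j) N1.
  by rewrite !ltnS !leqn0 => /eqP j0 /eqP i0; rewrite /= i0 j0.
have -> : laplacian A = 0.
  apply/matrixP => i j; rewrite !mxE (eqI i j) eqxx.
  by rewrite big1// => k; rewrite (eqI k j) eqxx.
rewrite tens0mx /lambda_2 (_ : [set _ | _] = set0) ?image_set0 ?ereal_inf0//.
apply/seteqP; split=> // a [/= /eigenvalueP[v + v0]] a0.
by rewrite mulmx0 => /esym/eqP; rewrite scaler_eq0 (negbTE a0) (negbTE v0).
Qed.

(** * Dissipation of the synchronization error *)

Section Rows.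
Variables (R : realType) (m n : nat).
Implicit Types (X Y : 'M[R]_(m, n)).

Lemma ip_rows X Y : ip X Y = \sum_i ip (row i X) (row i Y).
Proof.
apply: eq_bigr => i _; rewrite /ip big_ord1; apply: eq_bigr => j _.
by rewrite !mxE.
Qed.

Lemma enorm_row_le X i : enorm (row i X) <= enorm X.
Proof.
rewrite -ler_sqr ?nnegrE ?enorm_ge0// !enorm_sqr (ip_rows X) (bigD1 i)//= lerDl.
by apply: sumr_ge0 => k _; exact: ip_ge0.
Qed.

(** Two nodes are at distance at most sqrt 2 |e|, so a bound on |e| slightly
    above emax / 2 still keeps all the pairs within distance emax. *)
Lemma row_sub_le X i k : i != k ->
  enorm (row i X - row k X) ^+ 2 <= 2 * enorm X ^+ 2.
Proof.
move=> ik; rewrite !enorm_sqr (ip_rows X) (bigD1 i)//= (bigD1 k) 1?eq_sym//=.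
have rest : 0 <= \sum_(j | (j != i) && (j != k)) ip (row j X) (row j X).
  by apply: sumr_ge0 => j _; exact: ip_ge0.
have := ip_ge0 (row i X + row k X).
rewrite ipBl !ipBr ipDl !ipDr (ipC (row k X) (row i X)).
lra.
Qed.

Lemma near_row X i (P : set 'rV[R]_n) :
  (\forall y \near row i X, P y) -> \forall Y \near X, P (row i Y).
Proof.
move=> /eball_nbhs[d d0 dP]; have := nbhs_eball X d0; apply: filterS => Y XY.
apply: dP; rewrite /eball/= -linearB/=.
exact: le_lt_trans (enorm_row_le _ _) XY.
Qed.

Lemma near_row_sub X i k (P : set 'rV[R]_n) :
  (\forall y \near row i X - row k X, P y) ->
  \forall Y \near X, P (row i Y - row k Y).
Proof.
move=> /eball_nbhs[d d0 dP]; have d2 : 0 < d / 2 by rewrite divr_gt0.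
have := nbhs_eball X d2; apply: filterS => Y; rewrite /eball/= => XY.
apply: dP; rewrite /eball/=.
have -> : row i Y - row k Y - (row i X - row k X) =
    row i (Y - X) - row k (Y - X) by apply/rowP => j; rewrite !mxE; ring.
apply: le_lt_trans (enormD _ _) _; rewrite enormN.
have := enorm_row_le (Y - X) i; have := enorm_row_le (Y - X) k; lra.
Qed.

End Rows.

Section CenteredSums.
Variables (R : realType) (N n : nat).
Implicit Types (x y : 'I_N -> 'rV[R]_n).

Lemma sum_ip_sub x y : \sum_i x i = 0 ->
  \sum_i \sum_k ip (x i - x k) (y i - y k) = 2 * N%:R * \sum_i ip (x i) (y i).
Proof.
move=> x0.
have cross0 : \sum_i \sum_k ip (x i) (y k) = 0.
  rewrite exchange_big big1// => k _.
  by rewrite -ip_suml x0 ip0l.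
have cross0' : \sum_i \sum_k ip (x k) (y i) = 0 by rewrite exchange_big.
have diag : \sum_i \sum_(k < N) ip (x i) (y i) = N%:R * \sum_i ip (x i) (y i).
  rewrite mulr_sumr; apply: eq_bigr => i _.
  by rewrite sumr_const card_ord mulr_natl.
have diag' : \sum_(i < N) \sum_k ip (x k) (y k) = N%:R * \sum_i ip (x i) (y i).
  by rewrite sumr_const card_ord mulr_natl.
have -> : \sum_i \sum_k ip (x i - x k) (y i - y k) =
    \sum_i \sum_(k < N) ip (x i) (y i) - \sum_i \sum_k ip (x i) (y k)
    - \sum_i \sum_k ip (x k) (y i) + \sum_(i < N) \sum_k ip (x k) (y k).
  rewrite -!sumrB -big_split; apply: eq_bigr => i _.
  rewrite -!sumrB -big_split; apply: eq_bigr => k _.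
  by rewrite ipBl !ipBr/=; ring.
by rewrite cross0 cross0' diag diag'; ring.
Qed.

(** A pairwise one-sided Lipschitz bound sums up to a bound around the mean:
    the mean itself never enters as an argument of the field. *)
Lemma sum_ip_le_pairs x y z : (0 < N)%N -> \sum_i x i = 0 ->
  (forall i k, i != k ->
     ip (x i - x k) (y i - y k) <= ip (x i - x k) (z i - z k)) ->
  \sum_i ip (x i) (y i) <= \sum_i ip (x i) (z i).
Proof.
move=> N0 x0 xyz; have N2 : 0 < 2 * N%:R :> R by rewrite mulr_gt0 ?ltr0n.
rewrite -(ler_pM2l N2) -!sum_ip_sub//.
apply: ler_sum => i _; apply: ler_sum => k _.
have [->|ik] := eqVneq i k; last exact: xyz.
by rewrite !subrr !ip0l.
Qed.

Lemma sum_enorm_le (X : 'M[R]_(N, n)) :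
  \sum_i enorm (row i X) <= Num.sqrt N%:R * enorm X.
Proof.
pose o : 'rV[R]_N := const_mx 1; pose a : 'rV[R]_N := \row_i enorm (row i X).
have -> : \sum_i enorm (row i X) = ip o a.
  by rewrite /ip big_ord1; apply: eq_bigr => i _; rewrite !mxE mul1r.
apply: le_trans (ip_le_enorm _ _) _; apply: ler_pM; rewrite ?enorm_ge0//.
  rewrite /enorm big_ord1; under eq_bigr => i _ do rewrite mxE expr1n.
  by rewrite sumr_const card_ord.
rewrite -ler_sqr ?nnegrE ?enorm_ge0// !enorm_sqr (ip_rows X) /ip big_ord1.
by apply: ler_sum => i _; rewrite mxE -expr2 enorm_sqr.
Qed.

End CenteredSums.

Section SyncError.
Variables (R : realType) (N n : nat).
Implicit Types (X Y : 'M[R]_(N, n)).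

Lemma sync_error_row X i :
  row i (sync_error X) = row i X - N%:R^-1 *: \sum_k row k X.
Proof. exact: rowK. Qed.

Lemma sync_error_row_sub X i k :
  row i (sync_error X) - row k (sync_error X) = row i X - row k X.
Proof. by rewrite !sync_error_row opprB addrA subrK. Qed.

Lemma sync_error_sum X : (0 < N)%N -> \sum_i row i (sync_error X) = 0.
Proof.
move=> N0; under eq_bigr => i _ do rewrite sync_error_row.
rewrite sumrB sumr_const card_ord -scaler_nat scalerA divff ?scale1r ?subrr//.
by rewrite pnatr_eq0 -lt0n.
Qed.

Lemma sync_errorB X Y : sync_error (X - Y) = sync_error X - sync_error Y.
Proof.
apply/row_matrixP => i; rewrite linearB/= !sync_error_row linearB/=.
under [\sum_k row k (X - Y)]eq_bigr => k _ do rewrite linearB/=.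
by rewrite sumrB scalerBr opprB; apply/rowP => j; rewrite !mxE; ring.
Qed.

(** The error is orthogonal to the states in which all the nodes agree. *)
Lemma ip_sync_error X Y : (0 < N)%N ->
  ip (sync_error X) (sync_error Y) = ip (sync_error X) Y.
Proof.
move=> N0; rewrite (ip_rows _ Y) ip_rows.
under eq_bigr => i _ do rewrite (sync_error_row Y) ipBr.
by rewrite sumrB -ip_suml sync_error_sum// ip0l subr0.
Qed.

Lemma enorm_sync_error X : (0 < N)%N -> enorm (sync_error X) <= enorm X.
Proof.
move=> N0; have := ip_le_enorm (sync_error X) X.
rewrite -ip_sync_error// -enorm_sqr expr2.
have [->|e0] := eqVneq (enorm (sync_error X)) 0; first by rewrite enorm_ge0.
by rewrite ler_pM2l// lt_neqAle eq_sym e0 enorm_ge0.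
Qed.

End SyncError.

Lemma bilinE (R : realType) (n : nat) (A : 'M[R]_n) (u v : 'rV[R]_n) :
  bilin A u v = ip (u *m A) v.
Proof.
by rewrite /bilin mxE /ip big_ord1; apply: eq_bigr => j _; rewrite [v^T _ _]mxE.
Qed.

Section Dissipation.
Variables (R : realType) (N n : nat) (A : 'M[R]_N) (W Ups : 'M[R]_n).
Variables (f : 'I_N -> R -> 'rV[R]_n -> 'rV[R]_n).
Variables (h eta : R -> 'rV[R]_n -> 'rV[R]_n) (c : R).
Variables (g : 'I_N -> R -> 'rV[R]_n -> 'rV[R]_n).
Hypotheses (N0 : (0 < N)%N) (hA : weighted_graph A).
Hypotheses (hW : is_diag_mx W) (hUps : is_diag_mx Ups) (c0 : 0 <= c).
Implicit Types (X Y : 'M[R]_(N, n)) (t : R).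

Lemma network_field_row t Y i : row i (network_field f c A eta t Y) =
  f i t (row i Y) - c *: \sum_j A i j *: eta t (row i Y - row j Y).
Proof. exact: rowK. Qed.

(** The columns of the error are mean-zero vectors of R^N, so that the gap of
    the Laplacian, scaled by each entry of Ups, compares the coupling with the
    linear part of the dynamics one coordinate at a time. *)
Lemma gap_dissipation (e : 'M[R]_(N, n)) (m : R) : \sum_i row i e = 0 ->
  (forall l (x : 'rV[R]_N), \sum_i x ord0 i = 0 ->
     W l l * ip x x - c * (Ups l l * dirichlet A x) <= - m * ip x x) ->
  \sum_i bilin W (row i e) (row i e) - c * (2^-1 * \sum_i \sum_j A i j *
     bilin Ups (row i e - row j e) (row i e - row j e))
  <= - m * ip e e.
Proof.
move=> e0 gap; pose x l : 'rV[R]_N := \row_i e i l.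
have diagE (D : 'M[R]_n) (u : 'rV[R]_n) : is_diag_mx D ->
    bilin D u u = \sum_l D l l * u ord0 l ^+ 2.
  move=> Dd; rewrite bilinE /ip big_ord1; apply: eq_bigr => l _.
  by rewrite mulmx_diag_coord//; ring.
have xx l : ip (x l) (x l) = \sum_i e i l ^+ 2.
  by rewrite /ip big_ord1; apply: eq_bigr => i _; rewrite mxE expr2.
have eeE : ip e e = \sum_l ip (x l) (x l).
  rewrite /ip exchange_big/=; apply: eq_bigr => l _.
  by rewrite big_ord1; apply: eq_bigr => i _; rewrite mxE.
have WE : \sum_i bilin W (row i e) (row i e) = \sum_l W l l * ip (x l) (x l).
  under eq_bigr => i _ do rewrite diagE//.
  rewrite exchange_big/=; apply: eq_bigr => l _; rewrite xx mulr_sumr.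
  by apply: eq_bigr => i _; rewrite mxE.
have UE : 2^-1 * \sum_i \sum_j A i j *
     bilin Ups (row i e - row j e) (row i e - row j e) =
    \sum_l Ups l l * dirichlet A (x l).
  under [in RHS]eq_bigr => l _ do rewrite /dirichlet mulrCA.
  rewrite -mulr_sumr; congr (_ * _).
  under [in RHS]eq_bigr => l _ do rewrite mulr_sumr.
  rewrite [RHS]exchange_big/=; apply: eq_bigr => i _.
  under [in RHS]eq_bigr => l _ do rewrite mulr_sumr.
  rewrite [RHS]exchange_big/=; apply: eq_bigr => j _.
  rewrite diagE// mulr_sumr; apply: eq_bigr => l _.
  by rewrite !mxE; ring.
rewrite WE UE eeE !mulr_sumr -sumrB; apply: ler_sum => l _.
apply: gap; transitivity ((\sum_i row i e) ord0 l); last by rewrite e0 mxE.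
by rewrite summxE; apply: eq_bigr => i _; rewrite !mxE.
Qed.

(** Each term of the field is paired with the error on its own: h through the
    differences between nodes, g by the Cauchy-Schwarz inequality, and the
    coupling by oddness, which turns its double sum into one over pairs of
    nodes. *)
Lemma network_dissipation t Y (m Mbar : R) : 0 <= Mbar ->
  (forall i x, f i t x = h t x + g i t x) ->
  (forall v, eta t (- v) = - eta t v) ->
  (forall i k, i != k ->
     bilin 1%:M (row i Y - row k Y) (h t (row i Y) - h t (row k Y)) <=
     bilin W (row i Y - row k Y) (row i Y - row k Y)) ->
  (forall i, enorm (g i t (row i Y)) <= Mbar) ->
  (forall i k, i != k ->
     bilin Ups (row i Y - row k Y) (row i Y - row k Y) <=
     bilin 1%:M (row i Y - row k Y) (eta t (row i Y - row k Y))) ->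
  (forall l (x : 'rV[R]_N), \sum_i x ord0 i = 0 ->
     W l l * ip x x - c * (Ups l l * dirichlet A x) <= - m * ip x x) ->
  ip (sync_error Y) (network_field f c A eta t Y) <=
    - m * enorm (sync_error Y) ^+ 2
    + Num.sqrt N%:R * Mbar * enorm (sync_error Y).
Proof.
move=> Mbar0 fE odd_eta quad gM coup gap; set e := sync_error Y.
have e0 : \sum_i row i e = 0 by exact: sync_error_sum.
have esub i k : row i Y - row k Y = row i e - row k e.
  by rewrite sync_error_row_sub.
have hpart : \sum_i ip (row i e) (h t (row i Y)) <=
    \sum_i bilin W (row i e) (row i e).
  under [leRHS]eq_bigr => i _ do rewrite bilinE ipC.
  apply: sum_ip_le_pairs => // i k ik; have := quad i k ik.
  by rewrite !bilinE mulmx1 esub mulmxBl (ipC (_ - _ *m _)).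
have gpart : \sum_i ip (row i e) (g i t (row i Y)) <=
    Num.sqrt N%:R * Mbar * enorm e.
  apply: (@le_trans _ _ (\sum_i enorm (row i e) * Mbar)).
    apply: ler_sum => i _; apply: le_trans (ip_le_enorm _ _) _.
    by rewrite ler_wpM2l ?enorm_ge0.
  rewrite -mulr_suml mulrAC ler_wpM2r//; exact: sum_enorm_le.
have etapart : 2^-1 * \sum_i \sum_j A i j *
     bilin Ups (row i e - row j e) (row i e - row j e) <=
    \sum_i \sum_j ip (row i e) (A i j *: eta t (row i Y - row j Y)).
  rewrite [leRHS]sum_symmetrize ler_wpM2l ?invr_ge0//.
  apply: ler_sum => i _; apply: ler_sum => j _.
  rewrite !ipZr (hA j i).1 -(opprB (row i Y)) odd_eta ipNr mulrN -mulrBr -ipBl.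
  rewrite ler_wpM2l ?(hA i j).2//.
  have [->|ij] := eqVneq i j; first by rewrite !subrr bilinE mul0mx !ip0l.
  by have := coup i j ij; rewrite !bilinE mulmx1 esub.
have -> : ip e (network_field f c A eta t Y) =
    \sum_i ip (row i e) (h t (row i Y)) + \sum_i ip (row i e) (g i t (row i Y))
    - c * \sum_i \sum_j ip (row i e) (A i j *: eta t (row i Y - row j Y)).
  rewrite ip_rows mulr_sumr -big_split -sumrB; apply: eq_bigr => i _.
  by rewrite network_field_row fE ipBr ipDr ipZr ip_sumr.
have := gap_dissipation e0 gap; rewrite enorm_sqr.
have := ler_wpM2l c0 etapart; lra.
Qed.

End Dissipation.

Lemma near_enorm_le (R : realType) (m n : nat) (z : 'M[R]_(m, n)) (d : R) :
  enorm z < d -> \forall y \near z, enorm y <= d.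
Proof.
rewrite -subr_gt0 => /(nbhs_eball z); apply: filterS => y zy.
have := enormD (y - z) z; rewrite subrK => /le_trans; apply.
by rewrite -lerBrDr; exact: ltW.
Qed.

Lemma near_sync_error (R : realType) (N n : nat) (X : 'M[R]_(N, n)) (d : R) :
  (0 < N)%N -> 0 < d ->
  \forall Y \near X, enorm (sync_error X - sync_error Y) < d.
Proof.
move=> N0 /(nbhs_eball X); apply: filterS => Y XY.
rewrite -enormN opprB -sync_errorB.
exact: le_lt_trans (enorm_sync_error _ N0) XY.
Qed.

Section FilippovDissipation.
Variables (R : realType) (N n : nat) (A : 'M[R]_N) (W Ups : 'M[R]_n).
Variables (f : 'I_N -> R -> 'rV[R]_n -> 'rV[R]_n).
Variables (h eta : R -> 'rV[R]_n -> 'rV[R]_n) (c : R).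
Variables (g : 'I_N -> R -> 'rV[R]_n -> 'rV[R]_n).
Hypotheses (n0 : (0 < n)%N) (N0 : (0 < N)%N) (hA : weighted_graph A).
Hypotheses (hW : is_diag_mx W) (hUps : is_diag_mx Ups) (c0 : 0 <= c).
Hypothesis fE : forall i (t : R) x, 0 <= t -> f i t x = h t x + g i t x.
Hypothesis odd_eta : forall (t : R) v, 0 <= t -> eta t (- v) = - eta t v.
Variables (Dh Deta : set 'rV[R]_n) (Dg : 'I_N -> set 'rV[R]_n).
Hypotheses (nullh : lebesgue_null (~` Dh)) (nulleta : lebesgue_null (~` Deta)).
Hypothesis nullg : forall i, lebesgue_null (~` Dg i).
Hypotheses (regh : regular_on h Dh) (regeta : regular_on eta Deta).
Hypothesis regg : forall i, regular_on (g i) (Dg i).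
Implicit Types (X Y : 'M[R]_(N, n)) (t : R).

Definition smooth_states : set 'M[R]_(N, n) :=
  [set Y | (forall i, Dh (row i Y) /\ Dg i (row i Y)) /\
           forall i k, i != k -> Deta (row i Y - row k Y)].

(** The differences of distinct rows depend on independent coordinates, so that
    switching sets of the coupling pull back to null sets; for equal rows the
    coupling vanishes and there is nothing to avoid. *)
Lemma null_nonsmooth_states : lebesgue_null (~` smooth_states).
Proof.
pose Sr i : set 'M[R]_(N, n) := [set Y | (~` Dh `|` ~` Dg i) (row i Y)].
pose Sd (p : 'I_N * 'I_N) : set 'M[R]_(N, n) :=
  if p.1 == p.2 then set0 else [set Y | (~` Deta) (row p.1 Y - row p.2 Y)].
apply: (@lebesgue_null_subset _ _ _ _ ((\bigcup_i Sr i) `|` (\bigcup_p Sd p))).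
  move=> Y nY; apply: contrapT => /not_orP[nr nd]; apply: nY; split.
    move=> i; split; apply: contrapT => nD; apply: nr; exists i => //.
      by left.
    by right.
  move=> i k ik; apply: contrapT => nD; apply: nd; exists (i, k) => //.
  by rewrite /Sd/= (negbTE ik).
apply: lebesgue_null_setU => //.
  apply: lebesgue_null_finite_bigcup => // i; apply: lebesgue_null_row => //.
  by apply: lebesgue_null_setU => //; exact: nullg.
apply: lebesgue_null_finite_bigcup => // -[i k]; rewrite /Sd/=.
case: eqVneq => [_|ik]; first exact: lebesgue_null0.
exact: (lebesgue_null_row_sub n0 ik nulleta).
Qed.

Lemma network_field_bounded_near t X : 0 <= t ->
  exists B, \forall Y \near X, smooth_states Y ->
    enorm (network_field f c A eta t Y) <= B.
Proof.
move=> t0.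
have eta0 : eta t 0 = 0.
  apply/eqP; have := odd_eta 0 t0; rewrite oppr0 => /eqP.
  by rewrite -addr_eq0 -mulr2n -scaler_nat scaler_eq0 pnatr_eq0/=.
have /choice[Bh hBh] i : exists B, \forall Y \near X,
    Dh (row i Y) -> enorm (h t (row i Y)) <= B.
  have [B hB] := (regh t0).2 (row i X); exists B.
  exact: (near_row (P := fun y => Dh y -> enorm (h t y) <= B) hB).
have /choice[Bg hBg] i : exists B, \forall Y \near X,
    Dg i (row i Y) -> enorm (g i t (row i Y)) <= B.
  have [B hB] := (regg i t0).2 (row i X); exists B.
  exact: (near_row (P := fun y => Dg i y -> enorm (g i t y) <= B) hB).
have /choice[Be hBe] (p : 'I_N * 'I_N) : exists B, \forall Y \near X,
    Deta (row p.1 Y - row p.2 Y) -> enorm (eta t (row p.1 Y - row p.2 Y)) <= B.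
  have [B hB] := (regeta t0).2 (row p.1 X - row p.2 X); exists B.
  exact: (near_row_sub (P := fun y => Deta y -> enorm (eta t y) <= B) hB).
pose Brow i := Bh i + Bg i + c * \sum_j A i j * `|Be (i, j)|.
pose B := Num.sqrt (\sum_(i < N) Brow i ^+ 2).
exists B.
have {}hBh := filter_forall (f := fun i (Y : 'M[R]_(N, n)) =>
  Dh (row i Y) -> enorm (h t (row i Y)) <= Bh i) (nbhs_filter X) hBh.
have {}hBg := filter_forall (f := fun i (Y : 'M[R]_(N, n)) =>
  Dg i (row i Y) -> enorm (g i t (row i Y)) <= Bg i) (nbhs_filter X) hBg.
have {}hBe := filter_forall (f := fun p (Y : 'M[R]_(N, n)) =>
  Deta (row p.1 Y - row p.2 Y) ->
  enorm (eta t (row p.1 Y - row p.2 Y)) <= Be p) (nbhs_filter X) hBe.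
apply: filterS3 hBh hBg hBe => Y hY gY eY [Drow Dsub].
have rowB i : enorm (row i (network_field f c A eta t Y)) <= Brow i.
  rewrite network_field_row fE//; apply: le_trans (enormD _ _) _.
  apply: lerD.
    apply: le_trans (enormD _ _) _; apply: lerD.
      by apply: hY; case: (Drow i).
    by apply: gY; case: (Drow i).
  rewrite enormN enormZ ger0_norm// ler_wpM2l//.
  apply: le_trans (enorm_sum _ _ _) _; apply: ler_sum => j _.
  rewrite enormZ ger0_norm ?(hA i j).2// ler_wpM2l ?(hA i j).2//.
  have [->|ij] := eqVneq i j.
    rewrite subrr eta0 (_ : enorm 0 = 0) ?normr_ge0//.
    by rewrite -(scale0r 0) enormZ normr0 mul0r.
  exact: le_trans (eY (i, j) (Dsub i j ij)) (ler_norm _).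
rewrite -ler_sqr ?nnegrE ?enorm_ge0 ?sqrtr_ge0//.
rewrite enorm_sqr sqr_sqrtr; last first.
  by apply: sumr_ge0 => i _; exact: sqr_ge0.
rewrite ip_rows; apply: ler_sum => i _; rewrite -enorm_sqr.
by rewrite ler_sqr ?nnegrE ?enorm_ge0 ?(le_trans (enorm_ge0 _) (rowB i)).
Qed.

(** On smooth states the network field is evaluated at points where each
    nonlinearity belongs to its own Filippov set, so the pointwise estimate
    holds there; it passes to the Filippov set of the network, which only sees
    almost every nearby state, because the right-hand side is continuous. *)
Lemma filippov_dissipation t X u (m Mbar emax : R) : 0 < t -> 0 <= Mbar ->
  QUAD 1%:M W h ->
  (forall i x v, filippov (g i) t x v -> enorm v <= Mbar) ->
  (forall z w, enorm z <= emax -> filippov eta t z w ->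
     bilin Ups z z <= bilin 1%:M z w) ->
  (forall l (x : 'rV[R]_N), \sum_i x ord0 i = 0 ->
     W l l * ip x x - c * (Ups l l * dirichlet A x) <= - m * ip x x) ->
  0 < emax -> 2 * enorm (sync_error X) ^+ 2 < emax ^+ 2 ->
  filippov (network_field f c A eta) t X u ->
  ip (sync_error X) u <= - m * enorm (sync_error X) ^+ 2
    + Num.sqrt N%:R * Mbar * enorm (sync_error X).
Proof.
move=> /ltW t0 Mbar0 quad gM coup gap emax0 Xemax Fu.
pose q (s : R) := - m * s ^+ 2 + Num.sqrt N%:R * Mbar * s.
rewrite -/(q (enorm (sync_error X))); apply/ler_addgt0Pr => k k0.
have k2 : 0 < k / 2 by rewrite divr_gt0.
have [B0 hB0] := network_field_bounded_near X t0.
pose B := `|B0| + 1; have Bgt0 : 0 < B by rewrite ltr_wpDl.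
have close_pairs : \forall Y \near X,
    forall p : 'I_N * 'I_N, p.1 != p.2 -> enorm (row p.1 Y - row p.2 Y) <= emax.
  apply: (filter_forall (f := fun p (Y : 'M[R]_(N, n)) => p.1 != p.2 ->
    enorm (row p.1 Y - row p.2 Y) <= emax) (nbhs_filter X)) => -[i j] /=.
  have [->|ij] := eqVneq i j; first by apply: nearW.
  have Xij : enorm (row i X - row j X) < emax.
    rewrite -ltr_sqr ?nnegrE ?enorm_ge0 ?(ltW emax0)//.
    by rewrite -sync_error_row_sub; exact: le_lt_trans (row_sub_le _ ij) Xemax.
  by have := near_row_sub (near_enorm_le Xij); apply: filterS.
have near_q : \forall Y \near X,
    q (enorm (sync_error Y)) < q (enorm (sync_error X)) + k / 2.
  have cq : {for enorm (sync_error X), continuous q}.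
    apply: continuousD; apply: continuousM; try exact: cst_continuous.
      exact: exprn_continuous.
    exact: cvg_id.
  have /cvgrPdist_lt/(_ _ k2)/nbhs_ballP[d /= d0 dq] := cq.
  have := near_sync_error X N0 d0; apply: filterS => Y XY.
  have /dq : ball (enorm (sync_error X)) d (enorm (sync_error Y)).
    by rewrite -ball_normE/=; exact: le_lt_trans (enorm_dist _ _) XY.
  by rewrite distrC => /(le_lt_trans (ler_norm _)); rewrite ltrBlDl.
have near_e := near_sync_error X N0 (divr_gt0 k2 Bgt0).
apply: (filippov_ip_le null_nonsmooth_states _ Fu).
have near2 := @filterI _ _ (nbhs_filter X) _ _ close_pairs near_q.
apply: (filterS3 (nbhs_filter X) _ near2 hB0 near_e) => Y [pairs qY] boundY eY /contrapT sY.
have [Drow Dsub] := sY.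
have -> : ip (sync_error X) (network_field f c A eta t Y) =
    ip (sync_error X - sync_error Y) (network_field f c A eta t Y) +
    ip (sync_error Y) (network_field f c A eta t Y) by rewrite ipBl subrK.
have dY : ip (sync_error Y) (network_field f c A eta t Y) <=
    q (enorm (sync_error Y)).
  apply: (network_dissipation (h := h) (g := g) N0 hA hW hUps c0) => //.
  - by move=> i x; exact: fE.
  - by move=> v; exact: odd_eta.
  - move=> i j _; apply: (quad t) => //; apply: (regh t0).1; first by case: (Drow i).
    by case: (Drow j).
  - move=> i; apply: (gM i (row i Y)); apply: (regg i t0).1.
    by case: (Drow i).
  - move=> i j ij; apply: coup; first exact: (pairs (i, j)).
    by apply: (regeta t0).1; exact: Dsub.
have rY : ip (sync_error X - sync_error Y) (network_field f c A eta t Y) <= k / 2.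
  apply: le_trans (ip_le_enorm _ _) _.
  have PB : enorm (network_field f c A eta t Y) <= B.
    apply: le_trans (boundY sY) _; apply: le_trans (ler_norm _) _.
    by rewrite lerDl.
  apply: (@le_trans _ _ (k / 2 / B * B)); last by rewrite divfK// gt_eqF.
  by apply: ler_pM => //; rewrite ?enorm_ge0// ltW.
lra.
Qed.

End FilippovDissipation.

(** * Error norm along a trajectory *)

Section RealTrajectory.
Variable R : realType.
Implicit Types (psi : R -> R) (a b s t : R).

Lemma ae_lebesgue_mono (P Q : R -> Prop) : (forall t, P t -> Q t) ->
  {ae lebesgue_measure, forall t, P t} -> {ae lebesgue_measure, forall t, Q t}.
Proof.
move=> PQ [E [mE E0 PE]]; exists E; split=> // t nQ; apply: PE => Pt.
exact/nQ/PQ.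
Qed.

Lemma ac_on_sub psi a b a' b' :
  a <= a' -> b' <= b -> ac_on a b psi -> ac_on a' b' psi.
Proof.
move=> aa bb ac eps /ac[delta d0 dP]; exists delta => // k u v uv.
apply: dP => i; have [h1 h2 h3] := uv i.
by split; [exact: le_trans h1|exact: h2|exact: le_trans bb].
Qed.

Lemma ac_on_unif_continuous psi a b : ac_on a b psi ->
  forall eps, 0 < eps -> exists2 delta, 0 < delta & forall s t,
    a <= s <= b -> a <= t <= b -> `|s - t| < delta -> `|psi s - psi t| < eps.
Proof.
move=> ac eps /ac[delta d0 dP]; exists delta => // s t.
wlog st : s t / s <= t.
  move=> H sab tab; case: (leP s t) => [|/ltW] st; first exact: H.
  by rewrite distrC (distrC (psi s)); exact: H.
move=> /andP[as_ _] /andP[_ tb] dst.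
have := dP 1%N (fun=> s) (fun=> t); rewrite !big_ord1 distrC => /(_ _ _ _).
apply=> //; first by move=> i j _ _ _; rewrite !ord1.
by rewrite distrC in dst; apply: le_lt_trans dst; exact: ler_norm.
Qed.

(** The case of a linear drift reduces to a nonpositive derivative by adding
    kappa * t to psi. *)
Lemma ac_decay psi a b (kappa : R) : a <= b -> ac_on a b psi -> 0 <= kappa ->
  {ae lebesgue_measure, forall t, a < t < b ->
     derivable psi t 1 /\ 'D_1 psi t <= - kappa} ->
  psi b <= psi a - kappa * (b - a).
Proof.
move=> ab ac k0 aepsi; pose phi t := psi t + kappa * t.
suff : phi b <= phi a by rewrite /phi; lra.
apply: ac_nonincreasing => //.
  move=> eps eps0; have eps2 : 0 < eps / 2 by rewrite divr_gt0.
  have [delta d0 dP] := ac _ eps2.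
  have k1 : 0 < kappa + 1 by rewrite ltr_wpDl.
  have d1 : 0 < eps / 2 / (kappa + 1) by rewrite divr_gt0.
  exists (Num.min delta (eps / 2 / (kappa + 1))); first by rewrite lt_min d0.
  move=> k u v uv tuv; rewrite lt_min => /andP[/(dP k u v uv tuv) psiP len].
  apply: (@le_lt_trans _ _ (\sum_(i < k) `|psi (v i) - psi (u i)| +
      kappa * \sum_(i < k) (v i - u i))).
    rewrite mulr_sumr -big_split/=; apply: ler_sum => i _.
    have [_ uvi _] := uv i.
    rewrite /phi (_ : _ - _ = (psi (v i) - psi (u i)) + kappa * (v i - u i)); last by ring.
    apply: le_trans (ler_normD _ _) _; rewrite lerD2l ger0_norm//.
    by rewrite mulr_ge0// subr_ge0.
  have sum0 : 0 <= \sum_(i < k) (v i - u i).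
    by apply: sumr_ge0 => i _; have [_ uvi _] := uv i; rewrite subr_ge0.
  rewrite (splitr eps) ltr_leD//.
  apply: (@le_trans _ _ ((kappa + 1) * \sum_(i < k) (v i - u i))).
    by rewrite ler_wpM2r// lerDl.
  by rewrite mulrC -ler_pdivlMr// ltW.
apply: ae_lebesgue_mono aepsi => t h /h[dpsi Dpsi].
have dk : is_derive t (1 : R) (fun s : R => kappa * s) kappa.
  apply: (@is_derive_eq _ _ _ (kappa \*: id) t 1 _ (kappa *: 1)).
  by rewrite /GRing.scale/= mulr1.
have dpsi' : is_derive t (1 : R) psi ('D_1 psi t) by exact: derivableP.
have dphi : is_derive t (1 : R) phi ('D_1 psi t + kappa) by exact: is_deriveD.
by split; [exact: ex_derive|rewrite derive_val; lra].
Qed.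

(** The first crossing of the level ell would be the end of an interval on
    which psi starts at ell, exceeds it, and does not increase. *)
Lemma ac_barrier psi a (ell rho : R) : ell < rho ->
  (forall b, a <= b -> ac_on a b psi) ->
  {ae lebesgue_measure, forall t, a < t -> ell < psi t < rho ->
     derivable psi t 1 /\ 'D_1 psi t <= 0} ->
  psi a <= ell -> forall t, a <= t -> psi t <= ell.
Proof.
move=> ellrho ac aepsi psia t1 at1; rewrite leNgt; apply/negP => t1ell.
have cont := ac_on_unif_continuous (ac _ at1).
pose S := [set s | a <= s <= t1 /\ psi s <= ell].
have Sa : S a by split; rewrite ?lexx.
have supS : has_sup S.
  split; first by exists a.
  by exists t1 => s [/andP[_ st1] _].
pose t0 := sup S.
have at0 : a <= t0 by exact: sup_upper_bound.
have t01 : t0 <= t1 by apply: ge_sup => [|s [/andP[_ st1] _]//]; exists a.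
have t0ell : psi t0 <= ell.
  rewrite leNgt; apply/negP; rewrite -subr_gt0 => /cont[delta d0 dP].
  have [s [/andP[as_ st1] sell] st0] := sup_adherent d0 supS.
  have st0' : s <= t0 by apply: sup_upper_bound => //; split; rewrite ?as_.
  have : `|psi t0 - psi s| < psi t0 - ell.
    apply: dP; rewrite ?at0 ?as_// ger0_norm ?subr_ge0//.
    by rewrite ltrBlDr addrC -ltrBlDr.
  move=> /(le_lt_trans (ler_norm _)); lra.
have above s : t0 < s -> s <= t1 -> ell < psi s.
  move=> t0s st1; rewrite ltNge; apply/negP => sell.
  have : s <= t0.
    by apply: sup_upper_bound => //; split => //; rewrite st1 (le_trans at0 (ltW t0s)).
  by rewrite leNgt t0s.
have t0lt1 : t0 < t1.
  by rewrite lt_neqAle t01 andbT; apply: contraTneq t1ell => <-; rewrite -leNgt.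
have := cont (rho - psi t0); rewrite subr_gt0 => /(_ (le_lt_trans t0ell ellrho)).
move=> [delta d0 dP].
pose t2 := Num.min t1 (t0 + delta / 2).
have t02 : t0 < t2 by rewrite lt_min t0lt1 ltrDl divr_gt0.
have t21 : t2 <= t1 by rewrite ge_min lexx.
suff : psi t2 <= psi t0.
  by move=> /le_trans/(_ t0ell); rewrite leNgt above.
apply: ac_nonincreasing; first exact: ltW.
  by apply: ac_on_sub (ac _ at1).
apply: ae_lebesgue_mono aepsi => t h /andP[t0t tt2]; apply: h.
  exact: le_lt_trans at0 t0t.
rewrite above ?(le_trans (ltW tt2))//=.
have : `|psi t - psi t0| < rho - psi t0.
  apply: dP.
  - by rewrite (le_trans at0 (ltW t0t)) (le_trans (ltW tt2)).
  - by rewrite at0.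
  - rewrite gtr0_norm ?subr_gt0// ltrBlDl; apply: lt_trans tt2 _.
    by rewrite gt_min ltrD2l ltr_pdivrMr// ltr_pMr// ltr1n orbT.
by move=> /(le_lt_trans (ler_norm _)); lra.
Qed.

(** Below rho, psi satisfies a linear differential inequality whose
    equilibrium is K / m: psi first stays below its initial bound, which keeps
    the inequality valid, then reaches and keeps any level above K / m. *)
Lemma ultimate_bound psi (m K R0 rho : R) : 0 < m -> 0 <= K ->
  (forall t, 0 <= psi t) ->
  (forall T, 0 <= T -> ac_on 0 T psi) ->
  {ae lebesgue_measure, forall t, 0 < t -> 0 < psi t < rho ->
     derivable psi t 1 /\ 'D_1 psi t <= - m * psi t + K} ->
  psi 0 <= R0 -> R0 < rho -> K / m <= R0 ->
  forall nu, 0 < nu -> exists2 t_nu, 0 < t_nu &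
    forall t, t_nu < t -> psi t <= K / m + nu.
Proof.
move=> m0 K0 psi0 ac aepsi init R0rho KR nu nu0.
have Km0 : 0 <= K / m by rewrite divr_ge0// ltW.
have slope t : K / m + nu < psi t -> - m * psi t + K <= - (m * nu).
  move=> tl; have : m * (K / m + nu) <= m * psi t by rewrite ler_pM2l// ltW.
  by rewrite mulrDr mulrCA divff ?gt_eqF// mulr1; lra.
have slope0 t : K / m < psi t -> - m * psi t + K <= 0.
  move=> tl; have : m * (K / m) <= m * psi t by rewrite ler_pM2l// ltW.
  by rewrite mulrCA divff ?gt_eqF// mulr1; lra.
have below_R0 : forall t, 0 <= t -> psi t <= R0.
  apply: (@ac_barrier _ _ _ rho) => //.
  apply: ae_lebesgue_mono aepsi => t h t0 /andP[tR trho].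
  have [|dpsi Dpsi] := h t0.
    by rewrite trho andbT (le_lt_trans _ tR)// (le_trans Km0).
  by split=> //; apply: le_trans Dpsi _; apply: slope0; exact: le_lt_trans tR.
have [R0nu|nuR0] := leP R0 (K / m + nu).
  exists 1 => // t t1; apply: le_trans R0nu; apply: below_R0.
  exact: le_trans (ltW t1).
have ell0 : 0 < K / m + nu by rewrite ltr_wpDl.
have mnu : 0 < m * nu by rewrite mulr_gt0.
have [t0 t0gt0 t0ell] : exists2 t0, 0 < t0 & psi t0 <= K / m + nu.
  apply: contrapT => never.
  have always t : 0 < t -> K / m + nu < psi t.
    by move=> t0; rewrite ltNge; apply/negP => tl; apply: never; exists t.
  have R00 : 0 <= R0 by rewrite (le_trans Km0).
  pose T := R0 / (m * nu) + 1.
  have T0 : 0 < T by rewrite ltr_wpDl// divr_ge0// ltW.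
  have : psi T <= psi 0 - m * nu * (T - 0).
    apply: ac_decay; [exact: ltW|exact: ac (ltW T0)|exact: ltW|].
    apply: ae_lebesgue_mono aepsi => t h /andP[t0 _].
    have [|dpsi Dpsi] := h t0.
      by rewrite (lt_trans ell0 (always _ t0)) (le_lt_trans (below_R0 _ (ltW t0))).
    by split=> //; apply: le_trans Dpsi _; apply: slope; exact: always.
  have -> : m * nu * (T - 0) = R0 + m * nu.
    by rewrite /T; field; rewrite !gt_eqF.
  have := psi0 T; lra.
exists t0 => // t t0t.
apply: (@ac_barrier psi t0 (K / m + nu) rho) => //.
- exact: lt_trans nuR0 R0rho.
- move=> b t0b; apply: ac_on_sub (ac b _) => //; first exact: ltW.
  exact: le_trans (ltW t0gt0) t0b.
- apply: ae_lebesgue_mono aepsi => s h t0s /andP[ls srho].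
  have [|dpsi Dpsi] := h (lt_trans t0gt0 t0s).
    by rewrite srho (lt_trans ell0).
  split=> //; apply: le_trans Dpsi _; apply: slope0.
  by apply: lt_trans ls; rewrite ltrDl.
- exact: ltW.
Qed.

End RealTrajectory.

(** The error depends linearly on the state, with norm at most one. *)
Lemma ac_enorm_sync_error (R : realType) (N n : nat) (X : R -> 'M[R]_(N, n)) a b :
  (0 < N)%N -> abs_continuous_on a b X ->
  ac_on a b (fun t => enorm (sync_error (X t))).
Proof.
move=> N0 ac eps /ac[delta d0 dP]; exists delta => // k u v uv tuv len.
apply: le_lt_trans (dP k u v uv tuv len); apply: ler_sum => i _.
apply: le_trans (enorm_dist _ _) _; rewrite -sync_errorB.
exact: enorm_sync_error.
Qed.

(** The norm is differentiable away from zero, and only the values above a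
    positive level matter; working with the norm instead of its square keeps
    the differential inequality linear. *)
Lemma is_derive_enorm_sync_error (R : realType) (N n : nat)
    (X : R -> 'M[R]_(N, n)) (t : R) : (0 < N)%N -> derivable X t 1 ->
  0 < enorm (sync_error (X t)) ->
  is_derive t (1 : R) (fun s => enorm (sync_error (X s)))
    (ip (sync_error (X t)) ('D_1 X t) / enorm (sync_error (X t))).
Proof.
move=> N0 dX e0; set D := 'D_1 X t.
have dXij i j : is_derive t (1 : R) (fun s => X s i j) (D i j).
  have -> : D i j = 'D_1 (fun s => X s i j) t by rewrite /D derive_mx// mxE.
  by apply: derivableP; exact: (derivable_mxP X t 1).1 dX i j.
have errE (Y : 'M[R]_(N, n)) i j :
    sync_error Y i j = Y i j - N%:R^-1 * \sum_k Y k j.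
  by rewrite !mxE summxE; congr (_ - _ * _); apply: eq_bigr => k _; rewrite mxE.
have de i j : is_derive t (1 : R) (fun s => sync_error (X s) i j)
    (sync_error D i j).
  have -> : (fun s => sync_error (X s) i j) =
      (fun s => X s i j) - N%:R^-1 \*: (\sum_k (fun s => X s k j)).
    by apply/funext => s; rewrite errE fct_sumE.
  by rewrite errE; apply: is_deriveB; apply: is_deriveZ.
have dphi : is_derive t (1 : R)
    (fun s => \sum_i \sum_j sync_error (X s) i j ^+ 2)
    (2 * ip (sync_error (X t)) D).
  have -> : (fun s => \sum_i \sum_j sync_error (X s) i j ^+ 2) =
      \sum_i \sum_j (fun s => sync_error (X s) i j) ^+ 2.
    apply/funext => s; rewrite fct_sumE; apply: eq_bigr => i _.
    by rewrite fct_sumE; apply: eq_bigr => j _; rewrite exprfctE.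
  rewrite -ip_sync_error// mulr_sumr.
  apply: is_derive_sum => i; rewrite mulr_sumr; apply: is_derive_sum => j.
  apply: is_derive_eq.
  by rewrite /GRing.scale/= expr1 mulrA.
have phi0 : 0 < \sum_i \sum_j sync_error (X t) i j ^+ 2.
  by move: e0; rewrite /enorm sqrtr_gt0.
have dpsi : is_derive t (1 : R) (fun s => enorm (sync_error (X s)))
    ((2 * enorm (sync_error (X t)))^-1 * (2 * ip (sync_error (X t)) D)).
  exact: (@is_derive1_comp _ Num.sqrt _ _ _ _ (is_derive1_sqrt phi0) dphi).
by apply: (is_derive_eq dpsi); field; rewrite gt_eqF.
Qed.

(** * Gains and conclusion *)

Lemma upper_block_diag (R : realType) (n r : nat) (hr : (r <= n)%N)
    (D : 'M[R]_n) : is_diag_mx D -> is_diag_mx (upper_block hr D).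
Proof.
move=> /is_diag_mxP Dd; apply/is_diag_mxP => i j ij; rewrite mxE Dd//.
Qed.

Lemma lower_block_diag (R : realType) (n r : nat) (hr : (r <= n)%N)
    (D : 'M[R]_n) : is_diag_mx D -> is_diag_mx (lower_block hr D).
Proof.
move=> /is_diag_mxP Dd; apply/is_diag_mxP => i j ij; rewrite mxE Dd//=.
by rewrite eqn_add2l.
Qed.

Lemma upper_index (n r : nat) (hr : (r <= n)%N) (l : 'I_n) : (l < r)%N ->
  exists i : 'I_r, widen_ord hr i = l.
Proof. by move=> lr; exists (Ordinal lr); apply: val_inj. Qed.

Lemma lower_index (n r : nat) (hr : (r <= n)%N) (l : 'I_n) : (r <= l)%N ->
  exists i : 'I_(n - r), cast_ord (subnKC hr) (rshift r i) = l.
Proof.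
move=> rl; have lt : (l - r < n - r)%N by rewrite ltn_sub2r// (leq_ltn_trans rl).
by exists (Ordinal lt); apply: val_inj; rewrite /= subnKC.
Qed.

Section Gains.
Variables (R : realType) (N n r : nat) (A : 'M[R]_N) (W Ups : 'M[R]_n).
Variables (hrn : (r <= n)%N) (Mbar emax c : R).
Hypotheses (r0 : (0 < r)%N) (N0 : (0 < N)%N) (emax0 : 0 < emax) (Mbar0 : 0 < Mbar).
Hypotheses (hW : is_diag_mx W) (hUps : is_diag_mx Ups).
Hypothesis hWneg : forall i : 'I_n, (r <= i)%N -> W i i < 0.
Hypothesis hUpspos : forall i : 'I_n, (i < r)%N -> 0 < Ups i i.
Hypothesis hUps0 : forall i : 'I_n, (r <= i)%N -> Ups i i = 0.
Hypothesis hii : (r < n)%N ->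
  (- ((Num.sqrt N%:R * Mbar)%:E / lambda_max (lower_block hrn W))
     <= (emax / 2)%:E)%E.
Hypothesis hc : (c_tilde hrn A W Ups Mbar emax < c%:E)%E.

Let K := Num.sqrt N%:R * Mbar.
Let K_gt0 : 0 < K. Proof. by rewrite mulr_gt0// sqrtr_gt0 ltr0n. Qed.

Lemma gain_gt0 : 0 < c.
Proof. by rewrite -lte_fin; apply: le_lt_trans hc; rewrite le_max lexx orbT. Qed.

(** Condition (ii), solved for the largest entry of the lower block. *)
Lemma lower_gain : (r < n)%N -> exists wL, [/\
  lambda_max (lower_block hrn W) = wL%:E, wL <= - (2 * K / emax) &
  forall l : 'I_n, (r <= l)%N -> W l l <= wL].
Proof.
move=> rn; have nr0 : (0 < n - r)%N by rewrite subn_gt0.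
have [i [lamE wmax]] := lambda_max_diag nr0 (lower_block_diag hrn hW).
move: lamE wmax; set wL := lower_block hrn W i i => lamE wmax.
have wL0 : wL < 0 by rewrite /wL mxE; apply: hWneg; exact: leq_addr.
exists wL; split=> // [|l /(lower_index hrn)[j <-]].
  have := hii rn; rewrite lamE inver lt_eqF// -EFinM -EFinN lee_fin -/K => h.
  rewrite lerNr ler_pdivrMr//.
  have : - (K / wL) * (- wL) <= emax / 2 * (- wL).
    by rewrite ler_wpM2r// oppr_ge0 ltW.
  rewrite mulrNN divfK ?lt_eqF//; lra.
by have := wmax j; rewrite [X in X <= _]mxE.
Qed.

(** Both terms of the maximum in m_nl are at most - 2 K / emax: the first by
    the choice of c, the second by condition (ii).  This is what makes K / m at
    most emax / 2. *)
Lemma gains : connected_graph A -> weighted_graph A -> (1 < N)%N ->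
  exists m : R, [/\ 0 < m, eps_bar hrn A W Ups Mbar c = (K / m)%:E,
    K / m <= emax / 2 &
    forall (l : 'I_n) (x : 'rV[R]_N), \sum_i x ord0 i = 0 ->
      W l l * ip x x - c * (Ups l l * dirichlet A x) <= - m * ip x x].
Proof.
move=> conn hA N1.
have Upsr l : 0 < upper_block hrn Ups l l by rewrite mxE hUpspos/=.
have [ell [l2E ell0 gap]] :=
  lambda_2_tens hA conn N1 r0 (upper_block_diag hrn hUps) Upsr.
have [i [lamE wmax]] := lambda_max_diag r0 (upper_block_diag hrn hW).
move: lamE wmax; set wU := upper_block hrn W i i => lamE wmax.
have cell : 2 * K / emax + wU < c * ell.
  move: hc; rewrite /c_tilde gt_max => /andP[+ _].
  rewrite l2E lamE inver gt_eqF// -EFinD -EFinM lte_fin ltr_pdivrMl//.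
  by rewrite /K mulrA [ell * c]mulrC.
have [w [wE wK wUp wLow]] : exists w : R, [/\
    maxe (lambda_max (upper_block hrn W) -
      c%:E * lambda_2 (laplacian A *t upper_block hrn Ups))%E
      (lambda_max (lower_block hrn W)) = w%:E,
    w <= - (2 * K / emax), wU - c * ell <= w &
    forall l : 'I_n, (r <= l)%N -> W l l <= w].
  rewrite lamE l2E -EFinM -EFinB; have [rn|nr] := ltnP r n.
    have [wL [-> wLK wLmax]] := lower_gain rn.
    exists (Num.max (wU - c * ell) wL); rewrite -EFin_max; split=> //.
    - by rewrite ge_max wLK andbT; lra.
    - by rewrite le_max lexx.
    - by move=> l /wLmax lw; rewrite le_max lw orbT.
  exists (wU - c * ell); rewrite lambda_max_nil; last first.
    by apply/eqP; rewrite subn_eq0.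
  rewrite maxeNy; split=> //; first lra.
  by move=> l rl; have := leq_trans (leq_ltn_trans rl (ltn_ord l)) nr; rewrite ltnn.
have K2 : 0 < 2 * K / emax by rewrite divr_gt0// mulr_gt0.
exists (- w); split.
- lra.
- rewrite /eps_bar /m_nl wE -EFinN inver gt_eqF; last by lra.
  by rewrite -EFinM [Mbar * _]mulrC.
- rewrite ler_pdivrMr; last by lra.
  have : emax / 2 * (2 * K / emax) <= emax / 2 * (- w).
    by rewrite ler_pM2l ?divr_gt0//; lra.
  by apply: le_trans; rewrite le_eqVlt; apply/predU1P; left; field; rewrite gt_eqF.
- move=> l x sx; rewrite opprK; have xx := ip_ge0 x.
  have [lr|rl] := ltnP l r; last first.
    rewrite hUps0// mul0r mulr0 subr0 ler_wpM2r//; exact: wLow.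
  have [j jl] := upper_index hrn lr.
  have WU : W l l <= wU by have := wmax j; rewrite [X in X <= _]mxE jl.
  have := gap j x sx; rewrite [upper_block _ _ _ _]mxE jl => Ugap.
  have := ler_wpM2l (ltW gain_gt0) Ugap.
  have := ler_wpM2r xx WU; have := ler_wpM2r xx wUp; lra.
Qed.

(** With one node lambda_2 is +oo, so the term with c drops out of m_nl. *)
Lemma eps_bar_single : (N <= 1)%N ->
  exists2 eps : R, eps%:E = eps_bar hrn A W Ups Mbar c & 0 <= eps.
Proof.
move=> N1; rewrite /eps_bar /m_nl lambda_2_single//.
have [i [-> _]] := lambda_max_diag r0 (upper_block_diag hrn hW).
rewrite gt0_muley ?lte_fin ?gain_gt0//= addeNy; have [rn|nr] := ltnP r n.
  have [wL [-> wLK _]] := lower_gain rn; rewrite maxNye -EFinN inver.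
  have K2 : 0 < 2 * K / emax by rewrite divr_gt0// mulr_gt0.
  rewrite gt_eqF; last by lra.
  exists (Mbar * Num.sqrt N%:R / - wL) => //.
  by rewrite divr_ge0 ?mulr_ge0 ?sqrtr_ge0 ?(ltW Mbar0)//; lra.
exists 0 => //; rewrite lambda_max_nil; last by apply/eqP; rewrite subn_eq0.
by rewrite maxNye/= mule0.
Qed.

End Gains.

Lemma sync_error_single (R : realType) (N n : nat) (X : 'M[R]_(N, n)) :
  (N <= 1)%N -> (0 < N)%N -> sync_error X = 0.
Proof.
move=> N1 N0; have NE : N%:R = 1 :> R.
  by rewrite (_ : N = 1%N)//; apply/eqP; rewrite eqn_leq N1.
apply/row_matrixP => i; rewrite sync_error_row row0.
have -> : \sum_k row k X = row i X.
  rewrite (bigD1 i)//= big1 ?addr0// => k; case/negP; apply/eqP/val_inj.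
  have := leq_trans (ltn_ord i) N1; have := leq_trans (ltn_ord k) N1.
  by rewrite !ltnS !leqn0 => /eqP k0 /eqP i0; rewrite /= i0 k0.
by rewrite NE invr1 scale1r subrr.
Qed.

(** Dividing the dissipation estimate by |e| gives a linear differential
    inequality for |e|. *)
Lemma trajectory_bound (R : realType) (N n : nat) (N0 : (0 < N)%N)
    (Phi : R -> 'M[R]_(N, n) -> 'M[R]_(N, n)) (X0 : 'M[R]_(N, n))
    (m K emax : R) : 0 < m -> 0 <= K -> 0 < emax -> K / m <= emax / 2 ->
  enorm (sync_error X0) <= emax / 2 ->
  (forall t X u, 0 < t -> 2 * enorm (sync_error X) ^+ 2 < emax ^+ 2 ->
     filippov Phi t X u ->
     ip (sync_error X) u <=
       - m * enorm (sync_error X) ^+ 2 + K * enorm (sync_error X)) ->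
  bounded_convergence Phi X0 (K / m).
Proof.
move=> m0 K0 emax0 Kemax init diss X [ac sol] X00.
pose psi t := enorm (sync_error (X t)).
(* any rho strictly between emax / 2 and emax / sqrt 2 *)
apply: (@ultimate_bound _ psi m K (emax / 2) (7 / 10 * emax)) => //.
- by move=> t; exact: enorm_ge0.
- move=> T T0; apply: (@ac_on_sub _ _ 0 (T + 1)) => //; first by rewrite lerDl.
  by apply: ac_enorm_sync_error => //; apply: ac; rewrite ltr_wpDl.
- apply: ae_lebesgue_mono sol => t h t0 /andP[e0 erho].
  have [dX FX] := h (ltW t0).
  have dpsi := is_derive_enorm_sync_error N0 dX e0.
  split; first exact: ex_derive.
  rewrite derive_val ler_pdivrMr//.
  have -> : (- m * psi t + K) * psi t = - m * psi t ^+ 2 + K * psi t by ring.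
  apply: (diss t) => //.
  have : psi t ^+ 2 < (7 / 10 * emax) ^+ 2.
    by rewrite ltr_sqr// nnegrE ?enorm_ge0// mulr_ge0// ltW.
  have := sqr_ge0 emax; rewrite exprMn /psi; lra.
- by rewrite /psi X00.
- lra.
Qed.

Theorem theorem4 (R : realType) (n N : nat) (hn : (0 < n)%N) (hN : (0 < N)%N)
  (A : 'M[R]_N) (hA : weighted_graph A) (hconn : connected_graph A)
  (W : 'M[R]_n) (hW : is_diag_mx W)
  (f : 'I_N -> R -> 'rV[R]_n -> 'rV[R]_n)
  (h : R -> 'rV[R]_n -> 'rV[R]_n)
  (g : 'I_N -> R -> 'rV[R]_n -> 'rV[R]_n)
  (hf : forall i, continuous_or_pws (f i))
  (hquad : forall i, QUAD_affine_with 1%:M W (f i) h (g i))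
  (M : 'I_N -> R)
  (hM : forall i (t : R) (x u : 'rV[R]_n), 0 < t ->
     filippov (g i) t x u -> enorm u < M i)
  (rbar : nat) (hrbar : (rbar <= n)%N)
  (hWnneg : forall i : 'I_n, (i < rbar)%N -> 0 <= W i i)
  (hWneg : forall i : 'I_n, (rbar <= i)%N -> W i i < 0)
  (eta : R -> 'rV[R]_n -> 'rV[R]_n)
  (heta : continuous_or_pws eta)
  (hodd : forall (t : R) (v : 'rV[R]_n), 0 <= t -> eta t (- v) = - eta t v)
  (emax : R) (hemax : 0 < emax)
  (r : nat) (hr0 : (0 < r)%N) (hrn : (r <= n)%N) (hrr : (rbar <= r)%N)
  (Ups : 'M[R]_n) (hUps : is_diag_mx Ups)
  (hUpspos : forall i : 'I_n, (i < r)%N -> 0 < Ups i i)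
  (hUps0 : forall i : 'I_n, (r <= i)%N -> Ups i i = 0)
  (hcoupling : forall (t : R) (z w : 'rV[R]_n), 0 <= t -> enorm z <= emax ->
     filippov eta t z w -> bilin Ups z z <= bilin 1%:M z w)
  (X0 : 'M[R]_(N, n))
  (hi : enorm (sync_error X0) <= emax / 2)
  (hii : (r < n)%N ->
     (- ((Num.sqrt N%:R * max_bound hN M)%:E / lambda_max (lower_block hrn W))
        <= (emax / 2)%:E)%E)
  (c : R) (hc : (c_tilde hrn A W Ups (max_bound hN M) emax < c%:E)%E) :
  exists2 eps : R,
    eps%:E = eps_bar hrn A W Ups (max_bound hN M) c &
    bounded_convergence (network_field f c A eta) X0 eps.
Proof.
pose i0 := Ordinal hN.
have hWneg' (i : 'I_n) : (r <= i)%N -> W i i < 0.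
  by move=> ri; apply: hWneg; exact: leq_trans ri.
have [Dh nullh regh] : exists2 D, lebesgue_null (~` D) & regular_on h D.
  by case: (hquad i0) => _ ch _ _ _; exact: continuous_or_pws_regular.
have [Deta nulleta regeta] := continuous_or_pws_regular hn heta.
have /choice[Dg hDg] i : exists D, lebesgue_null (~` D) /\ regular_on (g i) D.
  case: (hquad i) => _ _ _ cg _.
  by have [D nD rD] := continuous_or_pws_regular hn cg; exists D.
have MleMbar i : M i <= max_bound hN M by exact: le_bigmax.
have Mbar0 : 0 < max_bound hN M.
  apply: lt_le_trans (MleMbar i0); have [nullD regD] := hDg i0.
  have [y [_ /contrapT Dy]] := lebesgue_null_eball (0 : 'rV[R]_n) ltr01 nullD.
  apply: le_lt_trans (enorm_ge0 (g i0 1 y)) _.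
  by apply: (hM i0 1 y) => //; exact: (regD 1 ler01).1.
have [N1|N1] := leqP N 1.
  have [eps epsE eps0] := eps_bar_single hr0 hN hemax Mbar0 hW hWneg' hii hc N1.
  exists eps => // X _ _ nu nu0; exists 1 => // t _.
  rewrite sync_error_single// (_ : enorm 0 = 0) ?addr_ge0 ?(ltW nu0)//.
  by rewrite -(scale0r 0) enormZ normr0 mul0r.
have [m [m0 epsE Kemax gap]] :=
  gains hr0 hN hemax Mbar0 hW hUps hWneg' hUpspos hUps0 hii hc hconn hA N1.
exists (Num.sqrt N%:R * max_bound hN M / m) => //.
apply: (trajectory_bound hN m0 _ hemax Kemax hi).
  by rewrite mulr_ge0 ?sqrtr_ge0// ltW.
move=> t X u t0 Xemax; have c0 := gain_gt0 hc.
apply: (filippov_dissipation (h := h) (g := g) (Dg := Dg) (emax := emax) hn hN hA hW hUps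
  (ltW c0) _ hodd nullh nulleta _ regh regeta _ t0 (ltW Mbar0)) => //.
- by move=> i s x s0; case: (hquad i) => fE _ _ _ _; exact: fE.
- by move=> i; case: (hDg i).
- by move=> i; case: (hDg i).
- by case: (hquad i0).
- move=> i x v /(hM i _ _ _ t0)/ltW/le_trans; apply; exact: MleMbar.
- by move=> z w; exact: (hcoupling t z w (ltW t0)).
Qed.
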